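(* Let $S$ be a set and $\Gamma\in\mathrm{Bypass}_S$. Then $$\mathcal{O}_{\mathrm{thh}}(\Gamma)\cong\begin{cases}(S^1)^{\amalg\mathrm{Eul}(\Gamma)}, & \text{if }\Gamma\neq\emptyset,\\ S, & \text{if }\Gamma=\emptyset,\end{cases}$$ where the disjoint union of circles is taken over the set $\mathrm{Eul}(\Gamma)$ of Eulerian tours on $\Gamma$, and $S$ is the ambient vertex set regarded as a discrete space.
   Context: $\mathrm{Top}$ is the $\infty$-category of spaces and $\mathcal{P}(\mathcal{C})=\mathrm{Fun}(\mathcal{C}^{\mathrm{op}},\mathrm{Top})$; objects of $\mathcal{C}$ are identified with representable presheaves. A directed multigraph on vertex set $S$ is a set $E$ of edges with source and target maps $s,t:E\to S$; it is finite if $E$ is finite. A bypass operation $f:\Gamma\to\Gamma'$ between graphs on the same vertex set is a function $f:E\to E'$ with a total ordering on each fiber $f^{-1}(e)$, such that: if $f^{-1}(e)=\emptyset$ then $s(e)=t(e)$; if $f^{-1}(e)=\{e_1<\cdots<e_k\}$ with $k\ge1$, then $t(e_i)=s(e_{i+1})$ for $1\le i<k$, $s(e_1)=s(e)$ and $t(e_k)=t(e)$. $\mathrm{Bypass}_S$ is the category of finite directed multigraphs on $S$ and bypass operations (fibers of composites are ordered lexicographically). $\emptyset$ is the graph with no edges. $(X_1,\dots,X_n)$ denotes the graph with edges $X_1\to X_2,\ \dots,\ X_{n-1}\to X_n$. An Eulerian tour on a nonempty finite graph is a total ordering of the edges such that they form a single closed path traversing each edge once; two tours differing by a cyclic permutation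 are regarded as the same. $\mathbb{T}_n$ is the category on objects $v_0,\dots,v_n$ freely generated by $e_i:v_i\to v_{i+1}$ ($0\le i<n$) and $e_n:v_n\to v_0$; each object has a degree $1$ endomorphism (once around the cycle). $\Lambda$ is the category of the $\mathbb{T}_n$ ($n\ge 0$) and functors preserving degree $1$ endomorphisms. $(\mathcal{O}_{\mathrm{thh}})_\bullet:\Lambda^{\mathrm{op}}\to\mathcal{P}(\mathrm{Bypass}_S)$ is the cyclic presheaf $(\mathcal{O}_{\mathrm{thh}})_n=\coprod_{X_0,\dots,X_n\in S}(X_0,X_1,\dots,X_n,X_0)$. For $f:\mathbb{T}_m\to\mathbb{T}_n$, with $f(e_i)=e_{i1}\cdots e_{ik}$ a composite of generators, the structure map $(X_0,\dots,X_n,X_0)\to(Y_0,\dots,Y_m,Y_0)$ (where $Y_i$ is the label of the vertex $f(v_i)$) replaces each path $e_{i1}\cdots e_{ik}$ by the single edge $e_i$, or introduces a loop if $k=0$. $\mathcal{O}_{\mathrm{thh}}\in\mathcal{P}(\mathrm{Bypass}_S)$ is the geometric realization of the underlying simplicial presheaf (restrict along $\Delta\to\Lambda$, $\{0<\cdots<n\}\mapsto\mathbb{T}_n$). *)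

(* Defs.v *)
From HB Require Import structures.
From mathcomp Require Import all_boot all_order all_algebra.
From mathcomp Require Import generic_quotient.
From mathcomp Require Import all_classical all_reals all_analysis.
Import Order.TTheory GRing.Theory Num.Theory.
Import numFieldNormedType.Exports.

Set Implicit Arguments.
Unset Strict Implicit.
Unset Printing Implicit Defensive.

Local Open Scope classical_set_scope.
Local Open Scope ring_scope.
Local Open Scope quotient_scope.

(** Composition is written in diagrammatic order: [cmp f g] is [f] then [g]. *)
Record category := Category {
  ob :> Type;
  hom : ob -> ob -> Type;
  idm : forall a, hom a a;
  cmp : forall a b c, hom a b -> hom b c -> hom a c;
  cmp1m : forall a b (f : hom a b), cmp (idm a) f = f;
  cmpm1 : forall a b (f : hom a b), cmp f (idm b) = f;
  cmpA : forall a b c d (f : hom a b) (g : hom b c) (h : hom c d),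
    cmp f (cmp g h) = cmp (cmp f g) h
}.
Arguments idm {_} _.
Arguments hom {_} _ _.

Definition op (C : category) : category :=
  @Category C (fun a b => hom b a) (@idm C) (fun a b c f g => cmp g f)
    (fun a b f => cmpm1 f) (fun a b f => cmp1m f)
    (fun a b c d f g h => esym (cmpA h g f)).

Definition Sets : category :=
  @Category Type (fun A B => A -> B) (fun A => id) (fun A B C f g => g \o f)
    (fun A B f => erefl) (fun A B f => erefl) (fun A B C D f g h => erefl).

Record functor (C D : category) := Functor {
  fob :> C -> D;
  fmor : forall a b : C, hom a b -> hom (fob a) (fob b);
  fmor1 : forall a : C, fmor (idm a) = idm (fob a);
  fmorM : forall (a b c : C) (f : hom a b) (g : hom b c),
    fmor (cmp f g) = cmp (fmor f) (fmor g)
}.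
Arguments fmor {C D} _ {a b} _.

Lemma functor_ext (C D : category) (o : C -> D)
    (m m' : forall a b : C, hom a b -> hom (o a) (o b)) p q p' q' :
  (forall (a b : C) (f : hom a b), m a b f = m' a b f) ->
  @Functor C D o m p q = @Functor C D o m' p' q'.
Proof.
move=> mm'.
have E : m = m' by do 3!apply: functional_extensionality_dep => ?; exact: mm'.
by case: _ / E p' q' {mm'} => p' q'; congr Functor; exact: Prop_irrelevance.
Qed.

Section FunctorOps.
Variables C D E : category.

Definition fid : functor C C :=
  @Functor C C id (fun a b f => f) (fun a => erefl) (fun a b c f g => erefl).

Lemma fcomp_subproof1 (F : functor C D) (G : functor D E) (a : C) :
  fmor G (fmor F (idm a)) = idm (G (F a)).
Proof. by rewrite !fmor1. Qed.

Lemma fcomp_subproofM (F : functor C D) (G : functor D E)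
    (a b c : C) (f : hom a b) (g : hom b c) :
  fmor G (fmor F (cmp f g)) = cmp (fmor G (fmor F f)) (fmor G (fmor F g)).
Proof. by rewrite !fmorM. Qed.

Definition fcomp (F : functor C D) (G : functor D E) : functor C E :=
  @Functor C E (fun a => G (F a)) (fun a b f => fmor G (fmor F f))
    (fcomp_subproof1 F G) (fcomp_subproofM F G).

Definition fop (F : functor C D) : functor (op C) (op D) :=
  @Functor (op C) (op D) F (fun a b f => fmor F f) (fun a => fmor1 F a)
    (fun a b c f g => fmorM F g f).

End FunctorOps.

Record nattrans (C D : category) (F G : functor C D) := NatTrans {
  ntm :> forall a : C, hom (F a) (G a);
  ntm_natural : forall (a b : C) (f : hom a b),
    cmp (fmor F f) (ntm b) = cmp (ntm a) (fmor G f)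
}.

Lemma nattrans_ext (C D : category) (F G : functor C D) (s t : nattrans F G) :
  (forall a, s a = t a) -> s = t.
Proof.
case: s t => [s ns] [t nt] /= st.
have E : s = t by apply: functional_extensionality_dep.
by case: _ / E nt {st} => nt; congr NatTrans; exact: Prop_irrelevance.
Qed.

Section FunctorCategory.
Variables C D : category.

Lemma ntid_subproof (F : functor C D) (a b : C) (f : hom a b) :
  cmp (fmor F f) (idm (F b)) = cmp (idm (F a)) (fmor F f).
Proof. by rewrite cmp1m cmpm1. Qed.

Definition ntid (F : functor C D) : nattrans F F := NatTrans (@ntid_subproof F).

Lemma ntcomp_subproof (F G H : functor C D) (s : nattrans F G)
    (t : nattrans G H) (a b : C) (f : hom a b) :
  cmp (fmor F f) (cmp (s b) (t b)) = cmp (cmp (s a) (t a)) (fmor H f).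
Proof. by rewrite cmpA ntm_natural -!cmpA ntm_natural. Qed.

Definition ntcomp (F G H : functor C D) (s : nattrans F G) (t : nattrans G H) :
  nattrans F H := NatTrans (@ntcomp_subproof F G H s t).

Lemma ntcomp1m (F G : functor C D) (s : nattrans F G) : ntcomp (ntid F) s = s.
Proof. by apply: nattrans_ext => a; rewrite /= cmp1m. Qed.

Lemma ntcompm1 (F G : functor C D) (s : nattrans F G) : ntcomp s (ntid G) = s.
Proof. by apply: nattrans_ext => a; rewrite /= cmpm1. Qed.

Lemma ntcompA (F G H K : functor C D) (s : nattrans F G) (t : nattrans G H)
  (u : nattrans H K) : ntcomp s (ntcomp t u) = ntcomp (ntcomp s t) u.
Proof. by apply: nattrans_ext => a; rewrite /= cmpA. Qed.

Definition Fun : category := Category ntcomp1m ntcompm1 ntcompA.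

End FunctorCategory.

Definition PSh (C : category) : category := Fun (op C) Sets.

Definition evaluation (C : category) (a : C) : functor (PSh C) Sets :=
  @Functor (PSh C) Sets (fun F : PSh C => fob F a) (fun F G s => s a)
    (fun F => erefl) (fun F G H s t => erefl).

Record graph (V : choiceType) := Graph {
  edge : finType;
  src : edge -> V;
  tgt : edge -> V
}.

Section Walks.
Variables (V : choiceType) (G : graph V).

(** [walk x p y]: the edges [p] are composable in this order and lead from [x]
    to [y]; the empty walk requires [x = y]. *)
Fixpoint walk (x : V) (p : seq (edge G)) (y : V) : bool :=
  if p is e :: p' then (src e == x) && walk (tgt e) p' y else x == y.

Lemma walk_cat x y z p q : walk x p y -> walk y q z -> walk x (p ++ q) z.
Proof.
elim: p x => [|e p IHp] x /=; first by move/eqP->.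
by case/andP=> -> wp wq /=; exact: IHp wp wq.
Qed.

End Walks.

Section BypassOperations.
Variable V : choiceType.

(** [bp_fib f e] lists the fibre of [f] over [e] in increasing order; a total
    order on a finite set is given by its duplicate-free increasing listing. *)
Record bypass (G H : graph V) := Bypass {
  bp_fun :> edge G -> edge H;
  bp_fib : edge H -> seq (edge G);
  bp_fib_uniq : forall e, uniq (bp_fib e);
  bp_fibE : forall e x, (x \in bp_fib e) = (bp_fun x == e);
  bp_walk : forall e, walk (src e) (bp_fib e) (tgt e)
}.

Lemma bypass_ext (G H : graph V) (f g : bypass G H) :
  bp_fib f =1 bp_fib g -> f = g.
Proof.
case: f g => [f p pu pE pw] [g q qu qE qw] /= /funext pq.
have fg : f = g by apply/funext => x; apply/esym/eqP; rewrite -qE -pq pE.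
case: _ / pq qu qE qw => qu qE qw; case: _ / fg qE => qE.
by congr Bypass; exact: Prop_irrelevance.
Qed.

Lemma bpid_subproofE (G : graph V) (e x : edge G) : (x \in [:: e]) = (x == e).
Proof. by rewrite inE. Qed.

Lemma bpid_subproofw (G : graph V) (e : edge G) : walk (src e) [:: e] (tgt e).
Proof. by rewrite /= !eqxx. Qed.

Definition bpid (G : graph V) : bypass G G :=
  @Bypass G G id (fun e => [:: e]) (fun e => isT) (@bpid_subproofE G)
    (@bpid_subproofw G).

Section Composition.
Variables (G H K : graph V) (f : bypass G H) (g : bypass H K).

(** Concatenating the ordered fibres of [f] along an ordered fibre of [g] is
    the lexicographic order. *)
Definition bpcomp_fib (e : edge K) : seq (edge G) :=
  flatten [seq bp_fib f e' | e' <- bp_fib g e].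

Lemma bpcomp_subproofu e : uniq (bpcomp_fib e).
Proof.
rewrite /bpcomp_fib; elim: (bp_fib g e) (bp_fib_uniq g e) => //= y s IHs.
case/andP=> ys us; rewrite cat_uniq bp_fib_uniq IHs // andbT.
apply/hasPn => x /flatten_mapP[z zs]; rewrite bp_fibE => /eqP fx.
by rewrite /= bp_fibE fx; apply: contraNneq ys => <-.
Qed.

Lemma bpcomp_subproofE e x : (x \in bpcomp_fib e) = (g (f x) == e).
Proof.
apply/flatten_mapP/idP => [[y]|gfx].
  by rewrite !bp_fibE => /eqP <- /eqP ->.
by exists (f x); rewrite ?bp_fibE.
Qed.

Lemma bpcomp_walk x p y : walk x p y ->
  walk x (flatten [seq bp_fib f e | e <- p]) y.
Proof.
elim: p x => //= e p IHp x /andP[/eqP <- wp].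
by apply: walk_cat (bp_walk f e) _; exact: IHp.
Qed.

Definition bpcomp : bypass G K :=
  @Bypass G K (g \o f) bpcomp_fib bpcomp_subproofu bpcomp_subproofE
    (fun e => bpcomp_walk (bp_walk g e)).

End Composition.

Lemma bpcomp1m (G H : graph V) (f : bypass G H) : bpcomp (bpid G) f = f.
Proof. by apply: bypass_ext => e; rewrite /= /bpcomp_fib /= flatten_map1 map_id. Qed.

Lemma bpcompm1 (G H : graph V) (f : bypass G H) : bpcomp f (bpid H) = f.
Proof. by apply: bypass_ext => e; rewrite /= /bpcomp_fib /= cats0. Qed.

Lemma bpcompA (G H K L : graph V) (f : bypass G H) (g : bypass H K)
  (h : bypass K L) : bpcomp f (bpcomp g h) = bpcomp (bpcomp f g) h.
Proof.
apply: bypass_ext => e; rewrite /= /bpcomp_fib /= /bpcomp_fib.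
by elim: (bp_fib h e) => //= y s IHs; rewrite map_cat flatten_cat IHs.
Qed.

Definition BypassCat : category := Category bpcomp1m bpcompm1 bpcompA.

End BypassOperations.

Section FreeCategory.
Variables (V : choiceType) (G : graph V).

Definition fpath (x y : V) := {p : seq (edge G) | walk x p y}.

Definition fpath_id (x : V) : fpath x x := exist _ [::] (eqxx x).

Definition fpath_comp (x y z : V) (p : fpath x y) (q : fpath y z) : fpath x z :=
  exist _ (sval p ++ sval q) (walk_cat (svalP p) (svalP q)).

Lemma fpath_comp1m x y (p : fpath x y) : fpath_comp (fpath_id x) p = p.
Proof. exact: val_inj. Qed.

Lemma fpath_compm1 x y (p : fpath x y) : fpath_comp p (fpath_id y) = p.
Proof. by apply: val_inj; rewrite /= cats0. Qed.

Lemma fpath_compA x y z t (p : fpath x y) (q : fpath y z) (r : fpath z t) :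
  fpath_comp p (fpath_comp q r) = fpath_comp (fpath_comp p q) r.
Proof. by apply: val_inj; rewrite /= catA. Qed.

Definition FreeCat : category :=
  Category fpath_comp1m fpath_compm1 fpath_compA.

Lemma fgen_subproof (e : edge G) : walk (src e) [:: e] (tgt e).
Proof. by rewrite /= !eqxx. Qed.

Definition fgen (e : edge G) : @hom FreeCat (src e) (tgt e) :=
  exist _ [:: e] (fgen_subproof e).

End FreeCategory.

(** [ordS i] is [i + 1] modulo [n + 1]; the edge [i] of [Tgraph n] is the
    generator [e_i : v_i -> v_(i+1)], with [e_n : v_n -> v_0]. *)
Definition Tgraph (n : nat) : graph 'I_n.+1 :=
  @Graph 'I_n.+1 'I_n.+1 id (@ordS n.+1).

Definition TT (n : nat) : category := FreeCat (Tgraph n).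

Definition word n (i j : TT n) (p : hom i j) : seq 'I_n.+1 :=
  sval (p : fpath (Tgraph n) i j).

Lemma wordP n (i j : TT n) (p : hom i j) : @walk _ (Tgraph n) i (word p) j.
Proof. exact: svalP (p : fpath (Tgraph n) i j). Qed.

Definition Tgen (n : nat) (i : 'I_n.+1) : @hom (TT n) i (ordS i) :=
  @fgen _ (Tgraph n) i.

Lemma walk_trajectE n (i j : 'I_n.+1) p :
  @walk _ (Tgraph n) i p j =
    (p == traject (@ordS n.+1) i (size p)) && (iter (size p) (@ordS n.+1) i == j).
Proof.
elim: p i => [|e p IHp] i //=.
rewrite eqseq_cons -andbA; case: (e =P i) => //= ->.
by rewrite IHp -iterSr.
Qed.

Lemma val_iter_ordS n (i : 'I_n.+1) k :
  (iter k (@ordS n.+1) i : nat) = ((i + k) %% n.+1)%N.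
Proof.
elim: k => [|k IHk] /=; first by rewrite addn0 modn_small.
by rewrite IHk -addn1 modnDml addn1 addnS.
Qed.

Lemma iter_ordS_full n (i : 'I_n.+1) : iter n.+1 (@ordS n.+1) i = i.
Proof. by apply/val_inj; rewrite [LHS]val_iter_ordS modnDr modn_small. Qed.

Lemma deg1_subproof n (i : 'I_n.+1) :
  @walk _ (Tgraph n) i (traject (@ordS n.+1) i n.+1) i.
Proof.
by rewrite walk_trajectE size_traject eqxx iter_ordS_full eqxx.
Qed.

(** Once around the cycle, starting at [v_i]. *)
Definition deg1 n (i : TT n) : hom i i :=
  exist (fun p => @walk _ (Tgraph n) i p i) _ (deg1_subproof i).

Definition preserves_deg1 m n (F : functor (TT m) (TT n)) : Prop :=
  forall i : TT m, fmor F (deg1 i) = deg1 (F i).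

Definition lam (m n : nat) : Type :=
  {F : functor (TT m) (TT n) | preserves_deg1 F}.

Lemma lam_id_subproof n : preserves_deg1 (fid (TT n)).
Proof. by []. Qed.

Definition lam_id (n : nat) : lam n n := exist _ _ (@lam_id_subproof n).

Lemma lam_comp_subproof m n p (F : lam m n) (G : lam n p) :
  preserves_deg1 (fcomp (sval F) (sval G)).
Proof. by move=> i; rewrite /= (svalP F) (svalP G). Qed.

Definition lam_comp m n p (F : lam m n) (G : lam n p) : lam m p :=
  exist _ _ (lam_comp_subproof F G).

Lemma lam_ext m n (F G : lam m n) : sval F = sval G -> F = G.
Proof. exact: eq_sig_hprop (fun _ => @Prop_irrelevance _) _ _. Qed.

Lemma lam_comp1m m n (F : lam m n) : lam_comp (lam_id m) F = F.
Proof. by apply: lam_ext; case: F => [[Fo h h1 hM] d] /=; exact: functor_ext. Qed.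

Lemma lam_compm1 m n (F : lam m n) : lam_comp F (lam_id n) = F.
Proof. by apply: lam_ext; case: F => [[Fo h h1 hM] d] /=; exact: functor_ext. Qed.

Lemma lam_compA m n p q (F : lam m n) (G : lam n p) (H : lam p q) :
  lam_comp F (lam_comp G H) = lam_comp (lam_comp F G) H.
Proof. by apply: lam_ext => /=; exact: functor_ext. Qed.

Definition Lambda : category := Category lam_comp1m lam_compm1 lam_compA.

(** The object [n] is [{0 < 1 < ... < n}]. *)
Definition is_monotone m n (f : 'I_m.+1 -> 'I_n.+1) : Prop :=
  {homo f : i j / (i <= j)%N}.

Definition delta_hom (m n : nat) : Type :=
  {f : 'I_m.+1 -> 'I_n.+1 | is_monotone f}.

Lemma mono_id_subproof n : is_monotone (id : 'I_n.+1 -> 'I_n.+1).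
Proof. by []. Qed.

Definition mono_id n : delta_hom n n := exist _ id (@mono_id_subproof n).

Lemma mono_comp_subproof m n p (f : delta_hom m n) (g : delta_hom n p) :
  is_monotone (sval g \o sval f).
Proof. by move=> i j ij; apply: (svalP g); exact: (svalP f). Qed.

Definition mono_comp m n p (f : delta_hom m n) (g : delta_hom n p) :
  delta_hom m p := exist _ (sval g \o sval f) (mono_comp_subproof f g).

Lemma mono_ext m n (f g : delta_hom m n) : sval f = sval g -> f = g.
Proof. exact: eq_sig_hprop (fun _ => @Prop_irrelevance _) _ _. Qed.

Lemma mono_comp1m m n (f : delta_hom m n) : mono_comp (mono_id m) f = f.
Proof. exact: mono_ext. Qed.

Lemma mono_compm1 m n (f : delta_hom m n) : mono_comp f (mono_id n) = f.
Proof. exact: mono_ext. Qed.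

Lemma mono_compA m n p q (f : delta_hom m n) (g : delta_hom n p)
  (h : delta_hom p q) : mono_comp f (mono_comp g h) = mono_comp (mono_comp f g) h.
Proof. exact: mono_ext. Qed.

Definition Delta : category := Category mono_comp1m mono_compm1 mono_compA.

Section DeltaLambda.

(** [Tlen f i] is the number of generators in the image of [e_i] under the
    functor [TT m -> TT n] induced by [f]: a generator [e_i] with [i < m] goes
    to the path from [f i] to [f (i + 1)] inside [0 -> 1 -> ... -> n], and the
    last one to the path from [f m] to [f 0] passing once through [e_n]. *)
Definition Tlen m n (f : delta_hom m n) (i : 'I_m.+1) : nat :=
  if i == ord_max then (n.+1 - sval f i + sval f ord0)%N
  else (sval f (ordS i) - sval f i)%N.

Definition Timg m n (f : delta_hom m n) (i : 'I_m.+1) : seq 'I_n.+1 :=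
  traject (@ordS n.+1) (sval f i) (Tlen f i).

Lemma ordS_max m : ordS (@ord_max m) = ord0.
Proof. by apply: val_inj; rewrite /= modnn. Qed.

Lemma val_ordS m (i : 'I_m.+1) : i != ord_max -> (ordS i : nat) = i.+1.
Proof.
move=> im; rewrite /= modn_small // ltnS ltn_neqAle -ltnS ltn_ord andbT.
by apply: contraNneq im => im; apply/eqP/val_inj.
Qed.

Lemma Tlen_eq m n (f : delta_hom m n) i :
  (sval f i + Tlen f i =
   (if i == ord_max then n.+1 else 0) + sval f (ordS i))%N.
Proof.
rewrite /Tlen; case: ifPn => [/eqP ->|im].
  by rewrite ordS_max addnA subnKC // ltnW.
rewrite add0n subnKC //; apply: (svalP f).
by rewrite val_ordS.
Qed.

Lemma Timg_walk m n (f : delta_hom m n) (i : 'I_m.+1) :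
  @walk _ (Tgraph n) (sval f i) (Timg f i) (sval f (ordS i)).
Proof.
rewrite walk_trajectE size_traject eqxx /=; apply/eqP/val_inj.
rewrite /= val_iter_ordS Tlen_eq; case: ifP => _.
  by rewrite modnDl modn_small.
by rewrite add0n modn_small.
Qed.

Lemma Tmap_subproof m n (f : delta_hom m n) (i j : 'I_m.+1) p :
  @walk _ (Tgraph m) i p j ->
  @walk _ (Tgraph n) (sval f i) (flatten [seq Timg f k | k <- p]) (sval f j).
Proof.
elim: p i => [|e p IHp] i /=; first by move/eqP ->.
by case/andP=> /eqP <- wp; apply: walk_cat (Timg_walk f e) _; exact: IHp.
Qed.

Definition Tmap m n (f : delta_hom m n) (i j : TT m) (p : hom i j) :
    @hom (TT n) (sval f i) (sval f j) :=
  exist (fun q => @walk _ (Tgraph n) (sval f i) q (sval f j)) _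
    (Tmap_subproof f (wordP p)).

Lemma Tmap1 m n (f : delta_hom m n) (i : TT m) :
  Tmap f (idm i) = idm (sval f i : TT n).
Proof. exact: val_inj. Qed.

Lemma TmapM m n (f : delta_hom m n) (i j k : TT m) (p : hom i j) (q : hom j k) :
  Tmap f (cmp p q) = cmp (Tmap f p) (Tmap f q).
Proof. by apply: val_inj; rewrite /= map_cat flatten_cat. Qed.

Definition Tfunctor m n (f : delta_hom m n) : functor (TT m) (TT n) :=
  @Functor (TT m) (TT n) (sval f) (@Tmap m n f) (Tmap1 f) (@TmapM m n f).

Lemma hom_TT_eq n (i j : TT n) (p q : hom i j) :
  size (word p) = size (word q) -> p = q.
Proof.
move=> pq; apply: val_inj; change (word p = word q).
have := wordP p; have := wordP q; rewrite !walk_trajectE.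
by move=> /andP[/eqP qE _] /andP[/eqP pE _]; rewrite pE qE pq.
Qed.

Lemma size_Tmap m n (f : delta_hom m n) (i : 'I_m.+1) k :
  (sval f i + size (flatten [seq Timg f j | j <- traject (@ordS m.+1) i k]) =
   (i + k) %/ m.+1 * n.+1 + sval f (iter k (@ordS m.+1) i))%N.
Proof.
elim: k => [|k IHk]; first by rewrite /= !addn0 divn_small ?mul0n ?add0n.
rewrite trajectSr map_rcons flatten_rcons size_cat addnA IHk /= size_traject.
rewrite -addnA Tlen_eq addnA; congr (_ + _)%N.
have itE := val_iter_ordS i k.
set e := iter k _ i in itE *.
have -> : (i + k.+1)%N = (((i + k) %/ m.+1) * m.+1 + e.+1)%N.
  by rewrite itE addnS addnS -divn_eq.
rewrite divnMDl //; case: eqP => [->|/eqP em].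
  by rewrite /= divnn /= mulnDl mul1n.
by rewrite -(val_ordS em) (divn_small (ltn_ord (ordS e))) !addn0.
Qed.

Lemma Tfunctor_deg1 m n (f : delta_hom m n) :
  preserves_deg1 (Tfunctor f).
Proof.
move=> i.
apply: hom_TT_eq; have := size_Tmap f i m.+1; rewrite iter_ordS_full => sz.
apply/eqP; rewrite -(eqn_add2l (sval f i)); apply/eqP.
apply: etrans sz _; rewrite size_traject.
by rewrite divnDr ?dvdnn // divn_small // divnn /= mul1n addnC.
Qed.

Definition DL_map (m n : Delta) (f : hom m n) : @hom Lambda m n :=
  exist _ (Tfunctor f) (Tfunctor_deg1 f).

Lemma size_hom_Tmap m n (f : delta_hom m n) (i j : TT m) (p : hom i j) :
  (sval f i + size (word (Tmap f p)) =
   (i + size (word p)) %/ m.+1 * n.+1 + sval f j)%N.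
Proof.
have := wordP p; rewrite walk_trajectE => /andP[/eqP pE /eqP jE].
by have := size_Tmap f i (size (word p)); rewrite jE -pE.
Qed.

Lemma DL_map1 (n : Delta) : DL_map (idm n) = @idm Lambda n.
Proof.
apply: lam_ext; apply: functor_ext => i j p; apply: hom_TT_eq.
apply/eqP; rewrite -(eqn_add2l i); apply/eqP.
rewrite [LHS](size_hom_Tmap (mono_id n) p) /=.
have := wordP p; rewrite walk_trajectE => /andP[_ /eqP jE].
have jv := val_iter_ordS i (size (word p)); rewrite jE in jv.
by rewrite jv -divn_eq.
Qed.

Lemma DL_mapM (m n p : Delta) (f : hom m n) (g : hom n p) :
  DL_map (cmp f g) = @cmp Lambda m n p (DL_map f) (DL_map g).
Proof.
apply: lam_ext; apply: functor_ext => i j q; apply: hom_TT_eq.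
apply/eqP; rewrite -(eqn_add2l (sval g (sval f i))); apply/eqP.
rewrite [LHS](size_hom_Tmap (mono_comp f g) q).
rewrite [RHS](size_hom_Tmap g (Tmap f q)) size_hom_Tmap.
by rewrite divnMDl // (divn_small (ltn_ord _)) addn0.
Qed.

Definition DeltaLambda : functor Delta Lambda :=
  @Functor Delta Lambda id DL_map DL_map1 DL_mapM.

End DeltaLambda.

Section Othh.
Variable S : choiceType.

(** [cycle_graph X] is [(X_0, ..., X_n, X_0)]; its edge [i] goes from [X_i] to
    [X_(i+1)], indices modulo [n + 1]. *)
Definition cycle_graph n (X : 'I_n.+1 -> S) : graph S :=
  @Graph S 'I_n.+1 X (X \o @ordS n.+1).

Section StructureMap.
Variables (m n : nat) (F : lam m n) (X : 'I_n.+1 -> S).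

Let Y : 'I_m.+1 -> S := X \o fob (sval F).

(** The fibre over the edge [i] is the path [F (e_i)]. *)
Definition smap_fib (i : 'I_m.+1) : seq 'I_n.+1 :=
  word (fmor (sval F) (Tgen i)).

Definition smap_fun (j : 'I_n.+1) : 'I_m.+1 :=
  odflt ord0 [pick i | j \in smap_fib i].

Lemma smap_path (i k : TT m) (p : hom i k) :
  word (fmor (sval F) p) = flatten [seq smap_fib e | e <- word p].
Proof.
case: p => p wp /=; elim: p i wp => [|e p IHp] i wp.
  have /eqP ik := wp; case: _ / ik wp => wp.
  have -> : exist _ [::] wp = @idm (TT m) i by exact: val_inj.
  by rewrite fmor1.
have [/eqP ei wp'] := andP wp; rewrite /= in ei; case: _ / ei wp => wp.
have -> : exist _ (e :: p) wp = @cmp (TT m) _ _ _ (Tgen e) (exist _ p wp').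
  exact: val_inj.
by rewrite fmorM; exact: (congr1 (cat (smap_fib e)) (IHp _ wp')).
Qed.

Lemma smap_flatten i :
  flatten [seq smap_fib e | e <- traject (@ordS m.+1) i m.+1] =
  traject (@ordS n.+1) (sval F i) n.+1.
Proof. by rewrite -(smap_path (deg1 i)) (svalP F). Qed.

Lemma traject_ordS_enum k (i : 'I_k.+1) :
  perm_eq (traject (@ordS k.+1) i k.+1) (enum 'I_k.+1).
Proof.
have ut : uniq (traject (@ordS k.+1) i k.+1).
  apply/(uniqP i) => a b; rewrite !inE size_traject => ak bk.
  rewrite !nth_traject // => /(congr1 val); rewrite /= !val_iter_ordS => /eqP.
  by rewrite eqn_modDl !modn_small // => /eqP.
apply: uniq_perm => //; first exact: enum_uniq.
have sub : {subset traject (@ordS k.+1) i k.+1 <= enum 'I_k.+1}.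
  by move=> x _; rewrite mem_enum.
by have [|] := uniq_min_size ut sub; rewrite ?size_traject ?size_enum_ord.
Qed.

Lemma smap_flatten_enum :
  perm_eq (flatten [seq smap_fib e | e <- enum 'I_m.+1]) (enum 'I_n.+1).
Proof.
apply: perm_trans (traject_ordS_enum (sval F ord0)).
rewrite -smap_flatten; apply: perm_flatten; apply: perm_map.
by rewrite perm_sym; exact: traject_ordS_enum.
Qed.

Lemma smap_subproofu i : uniq (smap_fib i).
Proof.
have := enum_uniq 'I_n.+1; rewrite -(perm_uniq smap_flatten_enum).
have /splitPr[s1 s2] : i \in enum 'I_m.+1 by rewrite mem_enum.
by rewrite map_cat flatten_cat /= !cat_uniq => /and3P[_ _ /andP[]].
Qed.

Lemma smap_subproofE i j : (j \in smap_fib i) = (smap_fun j == i).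
Proof.
have disj i1 i2 : j \in smap_fib i1 -> j \in smap_fib i2 -> i1 = i2.
  move=> j1 j2; case: (eqVneq i1 i2) => // i12.
  have := enum_uniq 'I_n.+1; rewrite -(perm_uniq smap_flatten_enum).
  have /perm_to_rem/(perm_map smap_fib)/perm_flatten/perm_uniq -> :
    i1 \in enum 'I_m.+1 by rewrite mem_enum.
  have j2' : j \in flatten [seq smap_fib e | e <- rem i1 (enum 'I_m.+1)].
    apply/flatten_mapP; exists i2 => //.
    by rewrite mem_rem_uniq ?enum_uniq // !inE eq_sym i12 mem_enum.
  by rewrite /= cat_uniq => /and3P[_ /hasPn/(_ _ j2')/=]; rewrite j1.
rewrite /smap_fun; case: pickP => [k jk|no] /=.
  by apply/idP/eqP => [ji|<- //]; exact: disj jk ji.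
have : j \in enum 'I_n.+1 by rewrite mem_enum.
by rewrite -(perm_mem smap_flatten_enum) => /flatten_mapP[k _]; rewrite no.
Qed.

Lemma smap_walk (i j : 'I_n.+1) p : @walk _ (Tgraph n) i p j ->
  @walk _ (cycle_graph X) (X i) p (X j).
Proof.
elim: p i => /= [i /eqP -> //|e p IHp i /andP[/eqP -> wp]].
by rewrite eqxx /=; exact: IHp.
Qed.

Definition smap : bypass (cycle_graph X) (cycle_graph Y) :=
  @Bypass S (cycle_graph X) (cycle_graph Y) smap_fun smap_fib smap_subproofu
    smap_subproofE (fun i => smap_walk (wordP (fmor (sval F) (Tgen i)))).

End StructureMap.

(** [(O_thh)_n] is the coproduct of the presheaves represented by the graphs
    [cycle_graph X]. *)
Definition othh_ob (n : nat) (G : BypassCat S) : Type :=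
  {X : 'I_n.+1 -> S & bypass G (cycle_graph X)}.

Definition othh_res n (G H : BypassCat S) (f : hom G H) (x : othh_ob n H) :
    othh_ob n G :=
  existT _ (projT1 x) (bpcomp f (projT2 x)).

Lemma othh_res1 n (G : BypassCat S) : @othh_res n G G (idm G) = id.
Proof. by apply/funext => -[X b]; rewrite /othh_res /= bpcomp1m. Qed.

Lemma othh_resM n (G H K : BypassCat S) (f : hom G H) (g : hom H K) :
  @othh_res n G K (cmp f g) = othh_res f \o othh_res g.
Proof. by apply/funext => -[X b]; rewrite /othh_res /= bpcompA. Qed.

Definition othh_level (n : nat) : PSh (BypassCat S) :=
  @Functor (op (BypassCat S)) Sets (othh_ob n)
    (fun G H f => @othh_res n H G f) (@othh_res1 n)
    (fun G H K f g => @othh_resM n K H G g f).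

Definition othh_map m n (F : lam m n) (G : BypassCat S) (x : othh_ob n G) :
    othh_ob m G :=
  existT _ (projT1 x \o fob (sval F)) (bpcomp (projT2 x) (smap F (projT1 x))).

Lemma othh_map_natural m n (F : lam m n) (G H : BypassCat S) (f : hom H G) :
  othh_map F (G := H) \o othh_res f = othh_res f \o othh_map F (G := G).
Proof. by apply/funext => -[X b]; rewrite /othh_res /othh_map /= bpcompA. Qed.

Definition othh_structure m n (F : lam m n) :
    hom (othh_level n) (othh_level m) :=
  @NatTrans (op (BypassCat S)) Sets (othh_level n) (othh_level m)
    (othh_map F) (fun G H f => othh_map_natural F f).

Lemma othh_structure1 n : othh_structure (lam_id n) = idm (othh_level n).
Proof.
apply: nattrans_ext => G; apply/funext => -[X b].
rewrite /= /othh_map /=; congr existT; apply: bypass_ext => i.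
by rewrite /= /bpcomp_fib /= cats0.
Qed.

Lemma othh_structureM m n p (F : lam m n) (H : lam n p) :
  othh_structure (lam_comp F H) =
  cmp (othh_structure H) (othh_structure F).
Proof.
apply: nattrans_ext => G; apply/funext => -[X b].
rewrite /= /othh_map /=; congr existT; rewrite -[RHS]bpcompA; congr bpcomp.
by apply: bypass_ext => i; rewrite /= /bpcomp_fib /= -smap_path.
Qed.

Definition othh_cyclic : functor (op Lambda) (PSh (BypassCat S)) :=
  @Functor (op Lambda) (PSh (BypassCat S)) othh_level
    (fun m n F => @othh_structure n m F) othh_structure1
    (fun m n p F H => @othh_structureM p n m H F).

Definition othh_simplicial : functor (op Delta) (PSh (BypassCat S)) :=
  fcomp (fop DeltaLambda) othh_cyclic.

End Othh.

Section Realization.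
Variable R : realType.

Definition simplex (n : nat) : set 'rV[R]_n.+1 :=
  [set t | (forall i, 0 <= t ord0 i) /\ \sum_i t ord0 i = 1].
Arguments simplex : clear implicits.

Section Pushforward.
Variables (m n : nat) (f : 'I_m.+1 -> 'I_n.+1).

Definition push_mx (t : 'rV[R]_m.+1) : 'rV[R]_n.+1 :=
  \row_j \sum_(i | f i == j) t ord0 i.

Lemma push_subproof (t : simplex m) : push_mx (set_val t) \in simplex n.
Proof.
have [t0 t1] : simplex m (set_val t) by exact: set_valP.
apply/mem_set; split=> [j|]; first by rewrite mxE sumr_ge0.
by under eq_bigr do rewrite mxE; rewrite -[RHS]t1 [RHS](partition_big f xpredT).
Qed.

Definition push (t : simplex m) : simplex n :=
  exist (fun u => u \in simplex n) _ (push_subproof t).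

End Pushforward.

Variable X : functor (op Delta) Sets.

(** The disjoint union over [n] and [x] in [X n] of copies of the simplex, that
    is, the disjoint union over [n] of [X n * simplex n] with [X n] discrete. *)
Definition presimplices : topologicalType :=
  {x : {classic {n : nat & X n}} & simplex (projT1 x) : topologicalType}.

Definition presimplex n (x : X n) (t : simplex n) : presimplices :=
  existT (fun x : {classic {n : nat & X n}} => simplex (projT1 x) : Type)
    (existT _ n x) t.

Inductive glued : presimplices -> presimplices -> Prop :=
| Glued m n (f : @hom Delta m n) (x : X n) (t : simplex m) :
    glued (presimplex (fmor X f x) t) (presimplex x (push (sval f) t))
| GluedRefl a : glued a a
| GluedSym a b : glued a b -> glued b a
| GluedTrans a b c : glued a b -> glued b c -> glued a c.

Definition gluedb (a b : presimplices) : bool := `[< glued a b >].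

Lemma gluedb_refl : reflexive gluedb.
Proof. by move=> a; apply/asboolP; exact: GluedRefl. Qed.

Lemma gluedb_sym : symmetric gluedb.
Proof. by move=> a b; apply/asboolP/asboolP; exact: GluedSym. Qed.

Lemma gluedb_trans : transitive gluedb.
Proof.
by move=> b a c /asboolP ab /asboolP bc; apply/asboolP; exact: GluedTrans bc.
Qed.

Definition glued_equiv := EquivRel gluedb gluedb_refl gluedb_sym gluedb_trans.

Definition realization : topologicalType :=
  quotient_topology {eq_quot glued_equiv}.

End Realization.

Definition homotopic (R : realType) (X Y : topologicalType) (f g : X -> Y) :=
  exists H : X * R -> Y,
    [/\ {within [set: X] `*` `[0, 1]%classic, continuous H},
        forall x, H (x, 0) = f x & forall x, H (x, 1) = g x].

Definition homotopy_equivalent (R : realType) (X Y : topologicalType) :=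
  exists (f : X -> Y) (g : Y -> X),
    [/\ continuous f, continuous g, homotopic R (g \o f) id
       & homotopic R (f \o g) id].

Definition circle (R : realType) : topologicalType :=
  [set p : R * R | p.1 ^+ 2 + p.2 ^+ 2 = 1].

Section Eulerian.
Variables (S : choiceType) (G : graph S).

(** A total order of the edges, as a listing of all of them; [cycle] also
    requires the last edge to end where the first one starts. The empty listing
    is accepted on the graph without edges, where tours are not considered. *)
Definition eulerian (l : seq (edge G)) : bool :=
  perm_eq l (enum (edge G)) && cycle (fun e e' => tgt e == src e') l.

Definition tour := {l : seq (edge G) | eulerian l}.

Definition same_tour (l l' : tour) : bool :=
  `[< exists k, sval l' = rot k (sval l) >].

Lemma same_tour_refl : reflexive same_tour.
Proof. by move=> l; apply/asboolP; exists 0%N; rewrite rot0. Qed.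

Lemma same_tour_sym : symmetric same_tour.
Proof.
have sym l l' : (exists k, sval l' = rot k (sval l)) ->
    exists k, sval l = rot k (sval l').
  case=> k E; exists (size (sval l') - k)%N.
  by rewrite -/(rotr k (sval l')) E rotK.
by move=> l l'; apply/asboolP/asboolP; exact: sym.
Qed.

Lemma same_tour_trans : transitive same_tour.
Proof.
move=> l' l l'' /asboolP[k E] /asboolP[k' E']; apply/asboolP.
by exists (rot_add (sval l) k k'); rewrite E' E rot_rot_add.
Qed.

Definition same_tour_equiv :=
  EquivRel same_tour same_tour_refl same_tour_sym same_tour_trans.

Definition Eul := {eq_quot same_tour_equiv}.

End Eulerian.

Definition coproduct (I : choiceType) (X : topologicalType) : topologicalType :=
  {_ : I & X}.

(** Colimits of presheaves of spaces are computed objectwise, so the value at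
    [G] of the realization of the simplicial presheaf is the homotopy type of
    the realization of the simplicial set of its values at [G]. *)
Definition Othh (R : realType) (S : choiceType) (G : graph S) :
    topologicalType :=
  realization R (fcomp (othh_simplicial S) (evaluation (G : BypassCat S))).

(* Main.v *)
Require Import Defs.
From mathcomp Require Import all_boot all_order all_algebra generic_quotient.
From mathcomp Require Import all_classical all_reals all_analysis.
From mathcomp Require Import ring lra.
Import Order.TTheory GRing.Theory Num.Theory.
Import numFieldNormedType.Exports.

Set Implicit Arguments.
Unset Strict Implicit.
Unset Printing Implicit Defensive.

(** Suppose that G has N > 0 edges. A bypass operation from G to a cyclic graph
    with n + 1 edges cuts a closed tour of the edges of G into n + 1 consecutive
    pieces, some possibly empty; as G has an edge, the pieces determine the
    vertices of the cyclic graph ([fibre_inj]). So an n-simplex of the simplicial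
    set Y at G is an Eulerian listing l of the edges, together with a monotone map
    from [n] to the cut positions {0, ..., N} of l. Every simplex is thus a
    pull-back of the N-simplex [full_cut l], in which l is cut at every position
    ([restr_full_cut]), and the realization is a union of N-simplices, one for
    each l. The only gluing is that of a face of [full_cut l] in which the first
    c positions are not used to the corresponding face of [full_cut (rot c l)].

    Lay out the positions of all the rotations of l on one real line, where l
    occupies [a, a + N] and rot c l occupies [a + c, a + c + N]. A point of the
    realization is then a probability measure on the integers with support in an
    interval of length N, up to translation by N, and the gluing only forgets
    which interval is used. The mean of the measure is therefore well defined
    modulo N, and together with the tour it defines the map [to_circles]. In the
    other direction, [of_circles] sends x to the measure of mean x carried by the
    two integers next to x. The mean of that measure is x, so one composite is the
    identity. For the other, let w be a measure with support in [a, a + N] and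
    mean x: as a and a + N are integers, the integers next to x lie in the same
    interval, so the segment from w to the two-point measure stays inside one
    simplex and defines a homotopy, [contraction]. All this commutes with
    translations, which is why the homotopy respects the gluing.

    Two topological facts are needed. A homotopy given on the disjoint union of
    the simplices descends to the realization because the product of a quotient
    map with a locally compact space is again a quotient map
    ([quotient_prod_continuous]). A path with equal ends descends from an interval
    to the circle because a continuous surjection of a compact space onto a
    Hausdorff space is a quotient map ([compact_hausdorff_descent]).

    If G has no edge, all the fibres are empty and force the labels of the cyclic
    graph to be equal, so Y is the constant simplicial set S. *)

(** * Simplices as tours cut into pieces *)

Lemma iter_ordS0 n (i : 'I_n.+1) : iter i (@ordS n.+1) ord0 = i.
Proof. by apply/val_inj; rewrite /= val_iter_ordS add0n modn_small. Qed.

Section Fibres.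
Variables (S : choiceType) (G : graph S).

Definition othhG : functor (op Delta) Sets :=
  fcomp (othh_simplicial S) (evaluation (G : BypassCat S)).

(** The simplicial structure maps, with the arrow of the simplex category seen
    as a monotone map. *)
Definition restr m n (f : delta_hom m n) (x : othhG n) : othhG m :=
  @fmor (op Delta) Sets othhG n m f x.

Lemma restr_comp m n p (f : delta_hom m n) (g : delta_hom n p) (x : othhG p) :
  restr f (restr g x) = restr (mono_comp f g) x.
Proof.
by have /(congr1 (@^~ x)) :=
  fmorM othhG (g : @Defs.hom (op Delta) p n) (f : @Defs.hom (op Delta) n m).
Qed.

Definition fibre n (x : othhG n) : 'I_n.+1 -> seq (edge G) := bp_fib (projT2 x).

Lemma fibre_map m n (f : delta_hom m n) (x : othhG n) i :
  fibre (restr f x) i = flatten [seq fibre x k | k <- Timg f i].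
Proof.
rewrite [LHS]/(flatten [seq fibre x k | k <- word (Tmap f (Tgen i))]).
by rewrite [word _]cats0. Qed.

(** The part of the tour read by going through [k] consecutive pieces of [x],
    cyclically, from piece [i] on. *)
Definition stretch n (x : othhG n) (i : 'I_n.+1) (k : nat) : seq (edge G) :=
  flatten [seq fibre x j | j <- traject (@ordS n.+1) i k].

Lemma stretchD n (x : othhG n) (i j : 'I_n.+1) k k' :
  iter k (@ordS n.+1) i = j ->
  stretch x i (k + k') = stretch x i k ++ stretch x j k'.
Proof. by move=> <-; rewrite /stretch trajectD map_cat flatten_cat. Qed.

Lemma stretch1 n (x : othhG n) i : stretch x i 1 = fibre x i.
Proof. exact: cats0. Qed.

Lemma stretch_walk n (x : othhG n) i k :
  walk (projT1 x i) (stretch x i k) (projT1 x (iter k (@ordS n.+1) i)).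
Proof.
apply: (@bpcomp_walk S G _ (projT2 x)).
apply: (@smap_walk S n (projT1 x)).
by rewrite walk_trajectE size_traject !eqxx.
Qed.

Definition pt_map n (i : 'I_n.+1) : delta_hom 0 n :=
  exist (fun f => is_monotone f) (fun=> i) (fun _ _ _ => leqnn i).

(** A vertex of [x] is the 0-simplex whose unique piece is the whole tour read
    from that vertex; this reduces the next lemma to 0-simplices. *)
Lemma fibre_pt n (x : othhG n) i :
  fibre (restr (pt_map i) x) ord0 = stretch x i n.+1.
Proof.
by rewrite fibre_map -[LHS]/(stretch x i (n.+1 - i + i)) subnK // ltnW.
Qed.

Lemma stretch_perm n (x : othhG n) i :
  perm_eq (stretch x i n.+1) (enum (edge G)).
Proof.
rewrite -fibre_pt; apply: uniq_perm; rewrite ?enum_uniq //.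
  exact: bp_fib_uniq.
move=> e; rewrite mem_enum [LHS]bp_fibE; apply/eqP.
exact: etrans (ord1 _) (esym (ord1 _)).
Qed.

Lemma walk_cycle (l : seq (edge G)) y :
  walk y l y -> cycle (fun e e' => tgt e == src e') l.
Proof.
case: l => //= e l /andP[/eqP <-].
suff H (e' : edge G) : walk (tgt e') l (src e) ->
    path (fun e e' => tgt e == src e') e' (rcons l e) by exact: H.
elim: l e' => /= [e' /eqP ->|e1 l IHl e' /andP[/eqP <-]]; first by rewrite eqxx.
by rewrite eqxx; exact: IHl.
Qed.

Lemma stretch_eulerian n (x : othhG n) i : eulerian (stretch x i n.+1).
Proof.
rewrite /eulerian stretch_perm; apply: (@walk_cycle _ (projT1 x i)).
by have := stretch_walk x i n.+1; rewrite iter_ordS_full.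
Qed.

Definition tour_of n (x : othhG n) : tour G :=
  exist (fun l => eulerian l) _ (stretch_eulerian x ord0).

Definition pos_nat n (x : othhG n) (i : 'I_n.+1) : nat := size (stretch x ord0 i).

Lemma stretch_split n (x : othhG n) (i j : 'I_n.+1) : i <= j ->
  stretch x ord0 j = stretch x ord0 i ++ stretch x i (j - i).
Proof.
by move=> ij; rewrite -(@stretchD _ x ord0 i) ?iter_ordS0 ?subnKC.
Qed.

Lemma tour_split n (x : othhG n) (i : 'I_n.+1) :
  sval (tour_of x) = stretch x ord0 i ++ stretch x i (n.+1 - i).
Proof.
rewrite /= -(@stretchD _ x ord0 i) ?iter_ordS0 //.
by rewrite subnKC // ltnW.
Qed.

(** Starting to read at piece [i] instead of piece 0 rotates the tour by the
    number of edges in the pieces skipped. *)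
Lemma stretch_rot n (x : othhG n) i :
  stretch x i n.+1 = rot (pos_nat x i) (sval (tour_of x)).
Proof.
have Ei : (i + (n.+1 - i) = n.+1)%N by rewrite subnKC // ltnW.
rewrite (tour_split x i) rot_size_cat -(@stretchD _ x i ord0) ?subnK // 1?ltnW //.
by apply/val_inj; rewrite /= val_iter_ordS Ei modnn.
Qed.

Lemma size_tour (l : tour G) : size (sval l) = #|edge G|.
Proof. by case/andP: (svalP l) => /perm_size ->; rewrite -cardE. Qed.

Lemma uniq_tour (l : tour G) : uniq (sval l).
Proof. by case/andP: (svalP l) => /perm_uniq -> _; rewrite enum_uniq. Qed.

Lemma mem_tour (l : tour G) e : e \in sval l.
Proof. by case/andP: (svalP l) => /perm_mem -> _; rewrite mem_enum. Qed.

Lemma rot_tour_subproof k (l : tour G) : eulerian (rot k (sval l)).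
Proof.
by case/andP: (svalP l) => pl cl; rewrite /eulerian perm_rot pl rot_cycle.
Qed.

Definition rot_tour k (l : tour G) : tour G :=
  exist (fun l => eulerian l) _ (rot_tour_subproof k l).

Lemma pos_subproof n (x : othhG n) i : pos_nat x i < #|edge G|.+1.
Proof.
by rewrite ltnS -(size_tour (tour_of x)) (tour_split x i) size_cat leq_addr.
Qed.

Definition pos n (x : othhG n) i : 'I_#|edge G|.+1 := Ordinal (pos_subproof x i).

Lemma pos_mono n (x : othhG n) : is_monotone (pos x).
Proof.
by move=> i j ij; rewrite /= /pos_nat (stretch_split _ ij) size_cat leq_addr.
Qed.

Definition pos_map n (x : othhG n) : delta_hom n #|edge G| :=
  exist (fun f => is_monotone f) _ (@pos_mono n x).

Lemma pos0 n (x : othhG n) : pos x ord0 = ord0.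
Proof. exact/val_inj. Qed.

(** This rotation is the reason why the listing attached to a simplex is not an
    invariant of its class in the realization, but only the tour is. *)
Lemma tour_of_map m n (f : delta_hom m n) (x : othhG n) :
  tour_of (restr f x) =
  rot_tour (pos x (sval f ord0)) (tour_of x).
Proof.
apply/val_inj; rewrite [RHS]/= -[RHS]stretch_rot [LHS]/= -!fibre_pt.
rewrite restr_comp; congr (fibre (restr _ x) _).
exact: mono_ext.
Qed.

(** After the rotation by [pos x (f 0)] the positions are counted from the new
    origin. Written as an addition to avoid truncated subtraction. *)
Lemma pos_map_val m n (f : delta_hom m n) (x : othhG n) i :
  (pos (restr f x) i + pos x (sval f ord0) = pos x (sval f i))%N.
Proof.
case: i => i /=; elim: i => [|i IHi] im.
  by rewrite /pos_nat /= add0n; congr (size (stretch _ _ (sval f _))); exact/val_inj.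
have im' := ltnW im; have := IHi im'.
set y := restr _ _; rewrite /pos_nat /= => E.
have iS : Ordinal im = ordS (Ordinal im') by apply/val_inj; rewrite /= modn_small.
have ij : (sval f (Ordinal im') <= sval f (Ordinal im))%N by apply: (svalP f).
have -> : stretch y ord0 i.+1 = stretch y ord0 i ++ fibre y (Ordinal im').
  rewrite -addn1 (@stretchD _ y ord0 (Ordinal im')) ?stretch1 //.
  exact: (iter_ordS0 (Ordinal im')).
rewrite size_cat addnAC E (stretch_split _ ij) size_cat; congr (_ + size _)%N.
rewrite /y fibre_map /Timg /Tlen iS -val_eqE /= ifF //.
by apply/negbTE; rewrite neq_ltn -ltnS im.
Qed.

Section Standard.
Variables (e0 : edge G) (l : tour G).

Let lE := svalP l.

(** Position [i] is labelled by the source of the next edge; rotating makes sense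
    of it at position N too, where the next edge is the first one. The default
    [e0] is never reached, since a tour contains [e0]. *)
Definition full_cut_ob (i : 'I_#|edge G|.+1) : S := src (head e0 (rot i (sval l))).

(** The piece after position [i] is the edge number [i], and the last piece, after
    position N, is empty. *)
Definition full_cut_fib (i : 'I_#|edge G|.+1) : seq (edge G) :=
  take 1 (drop i (sval l)).

Definition full_cut_fun (e : edge G) : 'I_#|edge G|.+1 := inord (index e (sval l)).

Lemma full_cut_subproofu i : uniq (full_cut_fib i).
Proof. by rewrite /full_cut_fib take_uniq // drop_uniq // uniq_tour. Qed.

Lemma full_cut_subproofE i e : (e \in full_cut_fib i) = (full_cut_fun e == i).
Proof.
have il : index e (sval l) < #|edge G| by rewrite -(size_tour l) index_mem mem_tour.
rewrite /full_cut_fun -val_eqE /= inordK ?ltnS 1?ltnW // /full_cut_fib.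
have [iN|iN] := ltnP i #|edge G|.
  rewrite (drop_nth e0) ?size_tour //= take0 inE.
  apply/eqP/eqP => [->|<-]; first by rewrite index_uniq ?size_tour ?uniq_tour.
  by rewrite nth_index // mem_tour.
rewrite drop_oversize ?size_tour //= in_nil; apply/esym/negbTE.
by rewrite neq_ltn (leq_trans il iN).
Qed.

Lemma full_cut_walk (i : 'I_#|edge G|.+1) :
  walk (full_cut_ob i) (full_cut_fib i) (full_cut_ob (ordS i)).
Proof.
rewrite /full_cut_fib /full_cut_ob; have [iN|iN] := ltnP i #|edge G|; last first.
  have -> : i = ord_max by apply/val_inj/eqP; rewrite /= eqn_leq -ltnS ltn_ord.
  by rewrite ordS_max /= drop_oversize ?size_tour //= rot0 rot_oversize ?size_tour.
have -> : (ordS i : nat) = i.+1 by rewrite /= modn_small // ltnS.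
case/andP: (lE) => _ cl.
have := cl; rewrite -(rot_cycle i) rotS ?size_tour //.
have [a [r [-> ->]]] : exists a r,
    rot i (sval l) = a :: r /\ take 1 (drop i (sval l)) = [:: a].
  rewrite /rot (drop_nth e0) ?size_tour //; do 2!eexists; split=> //.
  by rewrite /= take0.
by rewrite rot1_cons /= eqxx; case: r => [|b r] /= /andP[].
Qed.

Definition full_cut : othhG #|edge G| :=
  existT _ full_cut_ob
    (@Bypass S G (cycle_graph full_cut_ob) full_cut_fun full_cut_fib
      full_cut_subproofu full_cut_subproofE full_cut_walk).

Lemma stretch_full_cut (i : 'I_#|edge G|.+1) k : (i + k <= #|edge G|.+1)%N ->
  stretch full_cut i k = take k (drop i (sval l)).
Proof.
elim: k i => [|k IHk] i ik; first by rewrite take0.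
rewrite -addn1 addnC (@stretchD _ full_cut i (ordS i)) // stretch1.
have -> : fibre full_cut i = take 1 (drop i (sval l)) by [].
have [iN|iN] := ltnP i #|edge G|.
  have iS : (ordS i : nat) = i.+1 by rewrite /= modn_small // ltnS.
  rewrite IHk ?iS ?addSnnS // (drop_nth e0) ?size_tour //=.
  by rewrite take0.
have k0 : k = 0%N.
  apply/eqP; rewrite -leqn0 -(leq_add2l #|edge G|) addn0 -ltnS.
  by rewrite (leq_trans _ ik) // addnS ltnS leq_add2r.
by rewrite k0 /= cats0.
Qed.

End Standard.

(** The label at [i] is the source of the first edge read from piece [i] on, once
    around; the edge [e0] guarantees that there is one. *)
Lemma fibre_inj (e0 : edge G) n (x y : othhG n) : fibre x =1 fibre y -> x = y.
Proof.
move=> xy.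
have src_head (z : othhG n) i : projT1 z i = src (head e0 (stretch z i n.+1)).
  have := stretch_walk z i n.+1; have := perm_size (stretch_perm z i).
  case: (stretch z i n.+1) => [|a s] /=; last by move=> _ /andP[/eqP].
  by move/esym/size0nil => E; have := mem_enum (edge G) e0; rewrite E.
have : projT1 x = projT1 y.
  apply/funext => i; rewrite !src_head; congr (src (head e0 (flatten _))).
  exact: eq_map.
case: x y {src_head} xy => [X x] [Y y] /= xy XY; case: _ / XY y xy => y xy.
by congr existT; exact: bypass_ext.
Qed.

(** Cutting [tour_of x] at all positions and then forgetting all the cuts but
    those of [x] gives [x] back. *)
Lemma restr_full_cut (e0 : edge G) n (x : othhG n) :
  restr (pos_map x) (full_cut e0 (tour_of x)) = x.
Proof.
apply: (fibre_inj e0) => i; rewrite fibre_map -[LHS]/(stretch _ _ _) /Tlen.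
(* The last piece goes around to position 0 of [x], which is position 0 of the
   tour: it is the rest of the tour, followed by the empty piece number N. *)
case: ifPn => [/eqP ->|im].
  rewrite [sval _ ord0]pos0 addn0 stretch_full_cut; last first.
    by rewrite subnKC // ltnW.
  rewrite (tour_split x ord_max) drop_size_cat // subSnn stretch1 take_oversize //.
  rewrite -(leq_add2l (pos x ord_max)) subnKC; last exact/ltnW.
  have := size_tour (tour_of x).
  by rewrite (tour_split x ord_max) size_cat subSnn stretch1 => ->.
have iS := val_ordS im.
have ij : (i <= ordS i)%N by rewrite iS.
have pij := pos_mono x ij.
rewrite stretch_full_cut; last by rewrite subnKC // ltnW.
rewrite (tour_split x (ordS i)) (stretch_split _ ij) iS subSnn stretch1.
rewrite -catA drop_size_cat // take_size_cat //.
rewrite /= {1}/pos_nat iS -addn1 (@stretchD _ x ord0 i) ?iter_ordS0 //.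
by rewrite size_cat addKn stretch1.
Qed.

Lemma tour_of_full_cut (e0 : edge G) (l : tour G) : tour_of (full_cut e0 l) = l.
Proof.
by apply: val_inj; rewrite /= stretch_full_cut // drop0 take_oversize ?size_tour.
Qed.

Lemma pos_full_cut (e0 : edge G) (l : tour G) i : pos (full_cut e0 l) i = i.
Proof.
apply/val_inj; rewrite /= /pos_nat stretch_full_cut ?add0n 1?ltnW //.
by rewrite drop0 size_takel // size_tour -ltnS.
Qed.

End Fibres.

Local Open Scope classical_set_scope.
Local Open Scope ring_scope.

(** * Descent of continuous maps to quotients, and the angle on the circle *)

(** By the tube lemma: for an open [W] and a compact [K], the points [y] with
    [{y} * K] inside [W] form a set whose preimage under the quotient map is open. *)
Lemma quotient_prod_continuous (T P : topologicalType) (Q0 : quotType P)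
    (Z : topologicalType) (f : quotient_topology Q0 * T -> Z) :
  (forall (s : T) (B : set T), nbhs s B ->
     exists K, [/\ nbhs s K, compact K & K `<=` B]) ->
  continuous (fun p : P * T => f (\pi_(quotient_topology Q0)%qT p.1, p.2)) ->
  continuous f.
Proof.
move=> Tcomp; set q := \pi_(quotient_topology Q0)%qT => cf.
apply/continuousP => W oW.
have oqW : open ((fun p : P * T => f (q p.1, p.2)) @^-1` W).
  by move/continuousP : cf; exact.
rewrite openE => -[y s] /= Wys.
have qy : q (repr y) = y by rewrite /q reprK.
have : nbhs (repr y, s) ((fun p : P * T => f (q p.1, p.2)) @^-1` W).
  by apply: open_nbhs_nbhs; split => //=; rewrite qy.
case=> -[A B]/= [Ap Bs] AB; have [K [Ks cK KB]] := Tcomp s B Bs.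
pose V := [set y' | forall k, K k -> W (f (y', k))].
have oV : open (q @^-1` V).
  rewrite openE => p' /= Vp'; move/compact_near_coveringP : cK.
  move=> /(_ P (nbhs p') (fun p k => W (f (q p, k)))); apply => k Kk.
  have : nbhs (p', k) ((fun p : P * T => f (q p.1, p.2)) @^-1` W).
    by apply: open_nbhs_nbhs; split => //=; exact: Vp'.
  case=> -[A' B']/= [Ap' Bk] AB'; exists (B', A') => // -[a b] [/= Bb Aa].
  exact: (AB' (b, a)).
exists (V, K) => /=; last by move=> [a b] [/= Va Kb]; exact: Va.
split=> //; apply: open_nbhs_nbhs; split; first exact: oV.
move=> k /KB Bk; rewrite -qy; apply: (AB (repr y, k)); split => //=.
exact: nbhs_singleton.
Qed.

Lemma real_compact_nbhs (R : realType) (s : R) (B : set R) :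
  nbhs s B -> exists K, [/\ nbhs s K, compact K & K `<=` B].
Proof.
move=> /nbhs_closedballP[e eB]; exists (closed_ball s e%:num); split => //.
  by apply/nbhs_closedballP; exists e.
exact: closed_ballR_compact.
Qed.

Lemma row_continuous (R : realType) n (Z : topologicalType)
    (f : Z -> 'rV[R]_n) :
  (forall j, continuous (fun z => f z ord0 j)) -> continuous f.
Proof.
move=> cf z A [P nP sA].
apply: (filterS (P := fun z => forall j, P ord0 j (f z ord0 j))).
  by move=> y Py; apply: sA => i j; rewrite (ord1 i).
apply: filter_forall => j; exact: cf.
Qed.

Lemma into_set_continuous (Z T : topologicalType) (A : set T) (f : Z -> A) :
  continuous (fun z => set_val (f z) : T) -> continuous f.
Proof.
move=> cf; apply/continuousP => B [C oC <-].
by move/continuousP : cf; exact.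
Qed.

Lemma set_val_continuous (T : topologicalType) (A : set T) :
  continuous (set_val : A -> T).
Proof. exact: initial_continuous. Qed.

Lemma sigT_prod_continuous (I : choiceType) (X : I -> topologicalType)
    (T Z : topologicalType) (f : {i & X i} * T -> Z) :
  (forall i, continuous (fun p : X i * T => f (existT X i p.1, p.2))) ->
  continuous f.
Proof.
move=> cf [[i x] s] U /(cf i (x, s)) [[A B]/= [Ax Bs] AB].
exists (existT X i @` A, B) => /=.
  by split; [exact: existT_nbhs|].
by move=> [_ t] /= [[y Ay <-] Bt]; exact: (AB (y, t)).
Qed.

(** The preimage under [g] of a closed set is the image under [e] of a closed part
    of [K], hence compact, hence closed. *)
Lemma compact_hausdorff_descent (X Y Z : topologicalType) (K : set X)
    (e : X -> Y) (c : X -> Z) (g : Y -> Z) :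
  compact K -> hausdorff_space Y -> continuous e -> continuous c ->
  (forall y, exists2 k, K k & e k = y) -> (forall k, K k -> g (e k) = c k) ->
  continuous g.
Proof.
move=> cK hY ce cc esurj gE; apply/continuous_closedP => C clC.
have -> : g @^-1` C = e @` (K `&` c @^-1` C).
  apply/seteqP; split=> [y|y [k [Kk]]] /=.
    by have [k Kk <-] := esurj y; rewrite gE // => Cck; exists k.
  by move=> Cck <-; rewrite gE.
apply: compact_closed => //; apply: continuous_compact.
  exact: continuous_subspaceT.
apply: compact_closedI => //.
by move/continuous_closedP : cc; apply.
Qed.

Lemma cluster_continuous_eq (X T : topologicalType) (f : X -> T) (p q : X) :
  hausdorff_space T -> continuous f -> cluster (nbhs p) q -> f p = f q.
Proof.
move=> hT cf pq; apply: hT => A B /cf pA /cf qB.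
by have [x [Ax Bx]] := pq _ _ pA qB; exists (f x).
Qed.

Lemma circle_hausdorff (R : realType) : hausdorff_space (circle R).
Proof.
move=> p q pq; apply: val_inj.
have cv : continuous (set_val : circle R -> R * R) by exact: set_val_continuous.
have c1 : continuous (fun z : circle R => (set_val z : R * R).1).
  by move=> z; apply: continuous_comp (cv z) _; exact: cvg_fst.
have c2 : continuous (fun z : circle R => (set_val z : R * R).2).
  by move=> z; apply: continuous_comp (cv z) _; exact: cvg_snd.
have := cluster_continuous_eq (@Rhausdorff R) c1 pq.
have := cluster_continuous_eq (@Rhausdorff R) c2 pq.
by rewrite !set_valE; case: p {pq} => -[? ?] ?; case: q => -[? ?] ? /= -> ->.
Qed.

Section CircleParametrization.
Variable R : realType.

Lemma circle_point_subproof (x : R) :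
  (cos x, sin x) \in [set p : R * R | p.1 ^+ 2 + p.2 ^+ 2 = 1].
Proof. by rewrite inE /= cos2Dsin2. Qed.

Definition circle_point (x : R) : circle R :=
  exist (fun p => p \in [set p : R * R | p.1 ^+ 2 + p.2 ^+ 2 = 1]) _
    (circle_point_subproof x).

Lemma circle_point_continuous : continuous circle_point.
Proof.
apply: into_set_continuous => x.
exact: (cvg_pair (@continuous_cos R x) (@continuous_sin R x)).
Qed.

Lemma circle_pointD2pi (x : R) : circle_point (x + pi *+ 2) = circle_point x.
Proof. by apply: val_inj; rewrite /= cosD2pi sinD2pi. Qed.

(** The angle in [0, 2 pi[; it jumps at the point (1, 0). *)
Definition angle (z : circle R) : R :=
  if 0 <= (val z).2 then acos (val z).1 else pi *+ 2 - acos (val z).1.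

Lemma circle_eq (z : circle R) : (val z).1 ^+ 2 + (val z).2 ^+ 2 = 1.
Proof. by case: z => z /= /set_mem. Qed.

Lemma circle_itv (z : circle R) : -1 <= (val z).1 <= 1.
Proof.
rewrite -ler_norml -(@expr_le1 _ 2) // real_normK ?num_real //.
have := circle_eq z; have := sqr_ge0 (val z).2; lra.
Qed.

Lemma angleK (z : circle R) : circle_point (angle z) = z.
Proof.
apply: val_inj => /=; have zb := circle_eq z; have zi := circle_itv z.
have sE : (val z).2 ^+ 2 = 1 - (val z).1 ^+ 2 by lra.
rewrite /angle; case: ifPn => z2.
  by rewrite acosK // sin_acos // -sE sqrtr_sqr ger0_norm // -surjective_pairing.
rewrite -[_ - _](addrC (- _)) cosD2pi sinD2pi cosN sinN acosK // sin_acos //.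
by rewrite -sE sqrtr_sqr ltr0_norm ?ltNge // opprK -surjective_pairing.
Qed.

Lemma angle_itv (z : circle R) : 0 <= angle z < pi *+ 2.
Proof.
have zi := circle_itv z; have a0 := acos_ge0 zi; have api := acos_lepi zi.
have pi0 := pi_gt0 R; rewrite /angle; case: ifPn => z2.
  rewrite a0 /=; lra.
have : acos (val z).1 != 0.
  apply/eqP => z0; have := sin_acos zi; rewrite z0 sin0 => /esym/eqP.
  rewrite sqrtr_eq0; have := circle_eq z; have : 0 < (val z).2 ^+ 2.
    by rewrite exprn_even_gt0 //=; apply: contraNneq z2 => ->.
  lra.
lra.
Qed.

Lemma circle_pointK (x : R) : 0 <= x < pi *+ 2 -> angle (circle_point x) = x.
Proof.
move=> /andP[x0 x2]; rewrite /angle /=.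
have [xpi|xpi] := leP x pi.
  by rewrite sin_ge0_pi ?x0 // cosK // in_itv /= x0.
have -> : cos x = cos (pi *+ 2 - x) by rewrite addrC cosD2pi cosN.
have s2 : sin x = - sin (pi *+ 2 - x) by rewrite addrC sinD2pi sinN opprK.
have : 0 < sin (pi *+ 2 - x).
  by apply: sin_gt0_pi; rewrite mulr2n; apply/andP; split; lra.
rewrite s2 oppr_ge0 => s0; rewrite leNgt s0 /= cosK ?opprB ?subrKC //.
by rewrite in_itv /= mulr2n; apply/andP; split; lra.
Qed.

Lemma angle_comp (Z : Type) (c : R -> Z) (x : R) :
  c 0 = c (pi *+ 2) -> 0 <= x <= pi *+ 2 -> c (angle (circle_point x)) = c x.
Proof.
move=> c02 /andP[x0]; rewrite le_eqVlt => /predU1P[->|x2].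
  rewrite -c02; congr c; rewrite -[pi *+ 2]add0r circle_pointD2pi.
  by rewrite circle_pointK // lexx /= mulrn_wgt0 ?pi_gt0.
by rewrite circle_pointK // x0.
Qed.

(** The jump of the angle is harmless for a path that takes the same value at 0
    and at 2 pi. *)
Lemma angle_descent (Z : topologicalType) (c : R -> Z) :
  continuous c -> c 0 = c (pi *+ 2) -> continuous (c \o @angle).
Proof.
move=> cc c02.
apply: (@compact_hausdorff_descent _ _ _ `[0, pi *+ 2]%classic circle_point c).
- exact: segment_compact.
- exact: circle_hausdorff.
- exact: circle_point_continuous.
- by [].
- move=> z; exists (angle z); last exact: angleK.
  by have /andP[a0 a2] := angle_itv z; rewrite /= in_itv /= a0 ltW.
- by move=> x /=; rewrite in_itv /= => x02; exact: angle_comp.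
Qed.

End CircleParametrization.

(** * Measures on cut positions *)

Section Weights.
Variable R : realType.

(** Retraction of the line onto [a, b]. It makes the paths and homotopies below
    total functions of a real parameter. *)
Definition clamp (a b x : R) : R := Num.max a (Num.min b x).

Lemma clamp_itv a b x : a <= b -> a <= clamp a b x <= b.
Proof. by move=> ab; rewrite /clamp le_max lexx /= ge_max ab ge_min lexx. Qed.

Lemma clamp_id a b x : a <= x <= b -> clamp a b x = x.
Proof. by move=> /andP[ax xb]; rewrite /clamp (min_idPr xb) (max_idPr ax). Qed.

Lemma clamp_continuous a b : continuous (clamp a b).
Proof.
move=> x; apply: (@continuous_max _ _ (cst a) (fun x => Num.min b x)).
  exact: cvg_cst.
by apply: (@continuous_min _ _ (cst b) id); [exact: cvg_cst|exact: cvg_id].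
Qed.

Definition weight n (t : @simplex R n) (i : 'I_n.+1) : R :=
  (val t : 'rV[R]_n.+1) ord0 i.

Lemma weight_ge0 n (t : @simplex R n) i : 0 <= weight t i.
Proof. by have [t0 _] := set_mem (valP t); exact: t0. Qed.

Lemma weight_sum n (t : @simplex R n) : \sum_i weight t i = 1.
Proof. by have [_ t1] := set_mem (valP t). Qed.

Lemma simplex_ext n (t u : @simplex R n) : weight t =1 weight u -> t = u.
Proof. by move=> tu; apply/val_inj/rowP => i; exact: tu. Qed.

Lemma weight_push m n (f : 'I_m.+1 -> 'I_n.+1) (t : @simplex R m) j :
  weight (push f t) j = \sum_(i | f i == j) weight t i.
Proof. by rewrite /weight /= mxE. Qed.

Lemma into_simplex_continuous n (Z : topologicalType) (f : Z -> @simplex R n) :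
  (forall j, continuous (fun z => weight (f z) j)) -> continuous f.
Proof.
move=> cf; apply: into_set_continuous; apply: row_continuous => j.
by rewrite set_valE; exact: cf.
Qed.

Lemma weight_continuous n (i : 'I_n.+1) :
  continuous (fun t : @simplex R n => weight t i).
Proof.
move=> t; apply: (@continuous_comp _ _ _
  (set_val : @simplex R n -> 'rV[R]_n.+1) (fun M : 'rV[R]_n.+1 => M ord0 i)).
  exact: set_val_continuous.
exact: coord_continuous.
Qed.

Lemma mul_continuous (Z : topologicalType) (f g : Z -> R) :
  continuous f -> continuous g -> continuous (fun z => f z * g z).
Proof. by move=> cf cg z; apply: cvgM; [exact: cf|exact: cg]. Qed.

Lemma sub_continuous (Z : topologicalType) (f g : Z -> R) :
  continuous f -> continuous g -> continuous (fun z => f z - g z).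
Proof. by move=> cf cg z; apply: cvgB; [exact: cf|exact: cg]. Qed.

Lemma sum_continuous (I : Type) (r : seq I) (P : pred I) (Z : topologicalType)
    (F : I -> Z -> R) :
  (forall i, continuous (F i)) -> continuous (fun z => \sum_(i <- r | P i) F i z).
Proof.
move=> cF; elim: r => [|i r IHr].
  by under eq_fun do rewrite big_nil; move=> z; exact: cvg_cst.
under eq_fun do rewrite big_cons; case: (P i) => // z.
by apply: cvgD; [exact: cF|exact: IHr].
Qed.

Lemma push_continuous m n (f : 'I_m.+1 -> 'I_n.+1) : continuous (@push R m n f).
Proof.
apply: into_simplex_continuous => j; under eq_fun do rewrite weight_push.
by apply: sum_continuous => i; exact: weight_continuous.
Qed.

Lemma push_comp m n p (f : 'I_m.+1 -> 'I_n.+1) (g : 'I_n.+1 -> 'I_p.+1)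
    (t : @simplex R m) :
  push g (push f t) = push (g \o f) t.
Proof.
apply: simplex_ext => k; rewrite !weight_push.
under eq_bigr do rewrite weight_push.
rewrite [RHS](partition_big f (fun j => g j == k)) //=.
apply: eq_bigr => j /eqP gj; apply: eq_bigl => i /=.
by case: (f i =P j) => [->|_]; rewrite ?gj ?eqxx ?andbF.
Qed.

Lemma eq_push m n (f g : 'I_m.+1 -> 'I_n.+1) (t : @simplex R m) :
  f =1 g -> push f t = push g t.
Proof. by move=> /funext ->. Qed.

Lemma push_id_on n (f : 'I_n.+1 -> 'I_n.+1) (t : @simplex R n) :
  (forall i, f i != i -> weight t i = 0) -> push f t = t.
Proof.
move=> tf; apply: simplex_ext => j; rewrite weight_push.
have [fj|fj] := eqVneq (f j) j.
  rewrite (bigD1 j) ?fj ?eqxx //= big1 ?addr0 // => i /andP[/eqP fi ij].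
  by apply: tf; rewrite fi eq_sym.
rewrite tf // big1 // => i /eqP fi; apply: tf.
by apply: contraNneq fj => fii; rewrite -{1}fi fii fi.
Qed.

Definition mean n (t : @simplex R n) : R := \sum_i weight t i * i%:R.

Lemma mean_push m n (f : 'I_m.+1 -> 'I_n.+1) (t : @simplex R m) :
  mean (push f t) = \sum_i weight t i * (f i)%:R.
Proof.
rewrite /mean [RHS](partition_big f xpredT) //=; apply: eq_bigr => j _.
rewrite weight_push mulr_suml; apply: eq_bigr => i /eqP fi.
by rewrite fi.
Qed.

Lemma mean_pushD m n (f g : 'I_m.+1 -> 'I_n.+1) (c : nat) (t : @simplex R m) :
  (forall i, g i + c = f i)%N -> mean (push g t) + c%:R = mean (push f t).
Proof.
move=> gf; have -> : c%:R = \sum_i weight t i * c%:R :> R.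
  by rewrite -mulr_suml weight_sum mul1r.
rewrite !mean_push -big_split /=.
by apply: eq_bigr => i _; rewrite -gf natrD mulrDr.
Qed.

Lemma mean_itv n (t : @simplex R n) : 0 <= mean t <= n%:R.
Proof.
apply/andP; split; first by apply: sumr_ge0 => i _; rewrite mulr_ge0 ?weight_ge0.
have -> : n%:R = \sum_i weight t i * n%:R :> R.
  by rewrite -mulr_suml weight_sum mul1r.
apply: ler_sum => i _.
by rewrite ler_wpM2l ?weight_ge0 // ler_nat -ltnS.
Qed.

Lemma mean_continuous n : continuous (@mean n).
Proof.
apply: sum_continuous => i; apply: mul_continuous; last exact: cst_continuous.
exact: weight_continuous.
Qed.

(** The weight of 0 in the measure of mean [x] carried by the integers next to
    [x], for [x] in [-1, 1]; written in this form it is visibly continuous. *)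
Definition tent (x : R) : R := Num.max 0 (1 - `|x|).

Lemma tent_continuous : continuous tent.
Proof.
move=> x; apply: (@continuous_max _ _ (cst 0) (fun x => 1 - `|x|)).
  exact: cvg_cst.
by apply: cvgB; [exact: cvg_cst|exact: norm_continuous].
Qed.

Lemma tent_ge0 x : 0 <= tent x.
Proof. by rewrite le_max lexx. Qed.

Lemma tent_eq0 x : 1 <= `|x| -> tent x = 0.
Proof. by move=> x1; apply/max_idPl; rewrite subr_le0. Qed.

Let pp (x : R) : R := Num.max 0 x.

(** Second differences of the positive part, so that the next two sums telescope. *)
Lemma tentE x : tent x = pp (x + 1) - pp x - (pp x - pp (x - 1)).
Proof.
rewrite /tent /pp; have [x0|x0] := leP 0 x.
  by rewrite ger0_norm //; do ![case: leP => ?]; lra.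
by rewrite ltr0_norm //; do ![case: leP => ?]; lra.
Qed.

Lemma tent_sum n x : 0 <= x <= n%:R -> \sum_(i < n.+1) tent (x - i%:R) = 1.
Proof.
move=> /andP[x0 xn].
have -> : \sum_(i < n.+1) tent (x - i%:R) =
    pp (x + 1) - pp x - (pp (x - n%:R) - pp (x - n%:R - 1)).
  elim: n {xn} => [|n IHn]; first by rewrite big_ord1 subr0 tentE.
  rewrite big_ord_recr /= IHn tentE.
  have -> : x - n.+1%:R + 1 = x - n%:R by rewrite -natr1; ring.
  have -> : x - n%:R - 1 = x - n.+1%:R by rewrite -natr1; ring.
  ring.
rewrite /pp; do ![case: leP => ?]; lra.
Qed.

Lemma tent_mean n x : 0 <= x <= n%:R -> \sum_(i < n.+1) tent (x - i%:R) * i%:R = x.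
Proof.
move=> /andP[x0 xn].
have -> : \sum_(i < n.+1) tent (x - i%:R) * i%:R =
    pp x - pp (x - n%:R) - n%:R * (pp (x - n%:R) - pp (x - n%:R - 1)).
  elim: n {xn} => [|n IHn]; first by rewrite big_ord1 subr0 mul0r mulr0 subrr subr0.
  rewrite big_ord_recr /= IHn tentE.
  have -> : x - n.+1%:R + 1 = x - n%:R by rewrite -natr1; ring.
  have -> : x - n%:R - 1 = x - n.+1%:R by rewrite -natr1; ring.
  rewrite -natr1; ring.
have -> : pp x = x by exact/max_idPr.
have -> : pp (x - n%:R) = 0 by apply/max_idPl; lra.
have -> : pp (x - n%:R - 1) = 0 by apply/max_idPl; lra.
ring.
Qed.

Section Spread.
Variable n : nat.

Lemma spread_subproof (x : R) :
  (\row_(j < n.+1) tent (clamp 0 n%:R x - j%:R)) \in @simplex R n.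
Proof.
apply/mem_set; split=> [j|]; first by rewrite mxE tent_ge0.
under eq_bigr do rewrite mxE.
by rewrite tent_sum // clamp_itv.
Qed.

(** The measure of mean [x] carried by the integers next to [x]. *)
Definition spread (x : R) : @simplex R n :=
  exist (fun u => u \in @simplex R n) _ (spread_subproof x).

Lemma weight_spread x i : 0 <= x <= n%:R -> weight (spread x) i = tent (x - i%:R).
Proof. by move=> xn; rewrite /weight /= mxE clamp_id. Qed.

Lemma spread_continuous : continuous spread.
Proof.
apply: into_simplex_continuous => j; rewrite /weight /=.
under eq_fun do rewrite mxE.
move=> x; apply: (@continuous_comp _ _ _ (fun x => clamp 0 n%:R x - j%:R) tent).
  by apply: cvgB; [exact: clamp_continuous|exact: cvg_cst].
exact: tent_continuous.
Qed.

Lemma mean_spread x : 0 <= x <= n%:R -> mean (spread x) = x.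
Proof.
move=> xn; rewrite /mean; under eq_bigr do rewrite weight_spread //.
exact: tent_mean.
Qed.

Lemma blend_subproof (s : R) (t u : @simplex R n) :
  (\row_(j < n.+1) ((1 - clamp 0 1 s) * weight t j + clamp 0 1 s * weight u j))
    \in @simplex R n.
Proof.
have /andP[s0 s1] := @clamp_itv 0 1 s ler01.
apply/mem_set; split=> [j|].
  by rewrite mxE addr_ge0 // mulr_ge0 ?weight_ge0 // subr_ge0.
under eq_bigr do rewrite mxE.
by rewrite big_split /= -!mulr_sumr !weight_sum !mulr1 subrK.
Qed.

Definition blend (s : R) (t u : @simplex R n) : @simplex R n :=
  exist (fun u => u \in @simplex R n) _ (blend_subproof s t u).

Lemma weight_blend s t u i :
  weight (blend s t u) i = (1 - clamp 0 1 s) * weight t i + clamp 0 1 s * weight u i.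
Proof. by rewrite /weight /= mxE. Qed.

Lemma blend0 t u : blend 0 t u = t.
Proof.
apply: simplex_ext => i; rewrite weight_blend clamp_id ?lexx ?ler01 //.
by rewrite subr0 mul1r mul0r addr0.
Qed.

Lemma blend1 t u : blend 1 t u = u.
Proof.
apply: simplex_ext => i; rewrite weight_blend clamp_id ?lexx ?ler01 //.
by rewrite subrr mul1r mul0r add0r.
Qed.

Lemma push_blend (f : 'I_n.+1 -> 'I_n.+1) s t u :
  push f (blend s t u) = blend s (push f t) (push f u).
Proof.
apply: simplex_ext => j; rewrite weight_push weight_blend !weight_push.
under eq_bigr do rewrite weight_blend.
by rewrite big_split /= -!mulr_sumr.
Qed.

Lemma blend_continuous (Z : topologicalType) (s : Z -> R) (t u : Z -> @simplex R n) :
  continuous s -> continuous t -> continuous u ->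
  continuous (fun z => blend (s z) (t z) (u z)).
Proof.
move=> cs ct cu; apply: into_simplex_continuous => j.
under eq_fun do rewrite weight_blend.
have cc : continuous (fun z => clamp 0 1 (s z)).
  by move=> z; apply: continuous_comp (cs z) _; exact: clamp_continuous.
have c1 : continuous (fun z => 1 - clamp 0 1 (s z)).
  by move=> z; apply: cvgB; [exact: cvg_cst|exact: cc].
have ctj : continuous (fun z => weight (t z) j).
  by move=> z; exact: continuous_comp (ct z) (@weight_continuous n j _).
have cuj : continuous (fun z => weight (u z) j).
  by move=> z; exact: continuous_comp (cu z) (@weight_continuous n j _).
move=> z; apply: cvgD; first exact: (mul_continuous c1 ctj).
exact: (mul_continuous cc cuj).
Qed.

End Spread.

Section Shift.
Variables (n : nat) (c : 'I_n.+1).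

(** A measure supported in [c, n] is fixed by [cut_fun], and [shift_fun] reads it
    from the origin [c]. Both are monotone maps of {0, ..., n} to itself, so a
    translation of measures stays within one simplex. *)
Definition cut_fun (i : 'I_n.+1) : 'I_n.+1 := if (i <= c)%N then c else i.

Lemma shift_subproof (i : 'I_n.+1) : (i - c < n.+1)%N.
Proof. exact: leq_ltn_trans (leq_subr _ _) (ltn_ord i). Qed.

Definition shift_fun (i : 'I_n.+1) : 'I_n.+1 := Ordinal (shift_subproof i).

Lemma cut_mono : is_monotone cut_fun.
Proof.
move=> i j ij; rewrite /cut_fun; case: (leqP i c) => ic; case: (leqP j c) => jc //.
  exact: ltnW.
by have := leq_trans ic (leq_trans ij jc); rewrite ltnn.
Qed.

Lemma shift_mono : is_monotone shift_fun.
Proof. by move=> i j ij; exact: leq_sub2r. Qed.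

Lemma shift_cut i : (shift_fun i + cut_fun ord0 = cut_fun i)%N.
Proof.
rewrite /cut_fun /=; case: leqP => ic; last exact/subnK/ltnW.
by move/eqP: ic => ->.
Qed.

(** The integers next to [x] are at least [c] as soon as [x] is. *)
Lemma cut_spread x : c%:R <= x <= n%:R -> push cut_fun (spread n x) = spread n x.
Proof.
move=> /andP[cx xn]; apply: push_id_on => i.
have x0 : 0 <= x <= n%:R by rewrite xn (le_trans _ cx).
rewrite /cut_fun weight_spread //; case: leqP => ic; last by rewrite eqxx.
move=> ci; apply: tent_eq0; rewrite ler_normr.
have : (i.+1%:R : R) <= c%:R.
  by rewrite ler_nat ltn_neqAle ic andbT; apply: contraNneq ci => /val_inj ->.
rewrite -natr1 => ?; apply/orP; left; lra.
Qed.

Lemma shift_spread x : c%:R <= x <= n%:R ->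
  push shift_fun (spread n x) = spread n (x - c%:R).
Proof.
move=> /andP[cx xn]; apply: simplex_ext => j; rewrite weight_push.
have x0 : 0 <= x <= n%:R by rewrite xn (le_trans _ cx).
rewrite weight_spread; last by have := ler0n R c; move=> ?; apply/andP; split; lra.
have tail (i : 'I_n.+1) : (i < c)%N -> weight (spread n x) i = 0.
  move=> ic; rewrite weight_spread //; apply: tent_eq0; rewrite ler_normr.
  have : (i.+1%:R : R) <= c%:R by rewrite ler_nat.
  rewrite -natr1 => ?; apply/orP; left; lra.
have [jc|jc] := ltnP (j + c) n.+1.
  rewrite (bigD1 (Ordinal jc)) /=; last by rewrite -val_eqE /= addnK.
  rewrite weight_spread // big1 ?addr0 /=.
    by rewrite natrD; congr tent; ring.
  move=> i /andP[/eqP/(congr1 val)/= ij ji]; apply: tail.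
  rewrite ltnNge; apply: contra ji => ci; apply/eqP/val_inj.
  by rewrite /= -ij subnK.
rewrite big1; last first.
  move=> i /eqP/(congr1 val)/= ij; apply: tail.
  by rewrite ltnNge; apply: contraL jc => ci; rewrite -ij subnK // -ltnNge.
apply/esym/tent_eq0; rewrite ler_normr.
have : (n.+1%:R : R) <= (j + c)%:R by rewrite ler_nat.
rewrite natrD -natr1 => ?; apply/orP; right; lra.
Qed.

End Shift.

End Weights.

(** * Maps out of a geometric realization *)

Section Realization.
Variables (R : realType) (X : functor (op Delta) Sets).

Definition rclass (a : presimplices R X) : realization R X :=
  (\pi_(quotient_topology {eq_quot glued_equiv R X}) a)%qT.

Lemma rclass_continuous : continuous rclass.
Proof. exact: pi_continuous. Qed.

Lemma presimplex_continuous n (x : X n) : continuous (@presimplex R X n x).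
Proof.
exact: (@existT_continuous _ _ (existT _ n x : {classic {n : nat & X n}})).
Qed.

Lemma rclass_glued m n (f : delta_hom m n) (x : X n) (t : @simplex R m) :
  rclass (presimplex (@fmor (op Delta) Sets X n m f x) t) =
  rclass (presimplex x (push (sval f) t)).
Proof. by apply/eqmodP/asboolP; exact: (@Glued R X m n f). Qed.

Lemma rclass_surj y :
  exists n (x : X n) (t : @simplex R n), y = rclass (presimplex x t).
Proof.
have -> : y = rclass (repr y) by rewrite /rclass reprK.
by case: (repr y) => -[n x] t; exists n, x, t.
Qed.

Section Descent.
Variables (Z : Type) (F : presimplices R X -> Z).

Hypothesis F_glued : forall m n (f : delta_hom m n) (x : X n) (t : @simplex R m),
  F (presimplex (@fmor (op Delta) Sets X n m f x) t) =
  F (presimplex x (push (sval f) t)).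

(** Evaluation at a representative; it is meaningful when [F] respects the gluing
    relation, by the next lemma. *)
Definition descend (y : realization R X) : Z := F (repr y).

Lemma descendE a : descend (rclass a) = F a.
Proof.
have H b c : glued b c -> F b = F c.
  by elim=> {b c} // b c d _ -> _ ->.
apply: H; have /eqmodP/asboolP := reprK (rclass a).
exact.
Qed.

End Descent.

Lemma descend_continuous (Z : topologicalType) (F : presimplices R X -> Z) :
  (forall m n (f : delta_hom m n) (x : X n) (t : @simplex R m),
    F (presimplex (@fmor (op Delta) Sets X n m f x) t) =
    F (presimplex x (push (sval f) t))) ->
  (forall n (x : X n), continuous (fun t => F (presimplex x t))) ->
  continuous (descend F).
Proof.
move=> FE cF; apply/quotient_continuous.
have -> : descend F \o \pi_(quotient_topology {eq_quot glued_equiv R X})%qT = F.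
  by apply/funext => a; exact: descendE.
apply/continuousP => A oA; apply/sigT_openP => -[n x].
by move/continuousP : (cF n x); exact.
Qed.

Lemma descend_homotopy_continuous (Z : topologicalType)
    (F : presimplices R X -> R -> Z) :
  (forall m n (f : delta_hom m n) (x : X n) (t : @simplex R m),
    F (presimplex (@fmor (op Delta) Sets X n m f x) t) =
    F (presimplex x (push (sval f) t))) ->
  (forall n (x : X n),
    continuous (fun p : @simplex R n * R => F (presimplex x p.1) p.2)) ->
  continuous (fun p : realization R X * R => descend F p.1 p.2).
Proof.
move=> FE cF; apply: quotient_prod_continuous; first exact: real_compact_nbhs.
have -> : (fun p : presimplices R X * R =>
    descend F (\pi_(quotient_topology {eq_quot glued_equiv R X})%qT p.1) p.2) =
  (fun p => F p.1 p.2).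
  by apply/funext => -[a s] /=; congr (_ s); exact: descendE.
by apply: sigT_prod_continuous => -[n x]; exact: cF.
Qed.

End Realization.

Lemma eq_homotopic (R : realType) (X Y : topologicalType) (f g : X -> Y) :
  continuous f -> f =1 g -> homotopic R f g.
Proof.
move=> cf fg; exists (f \o fst); split => //=; apply: continuous_subspaceT => p.
by apply: continuous_comp (cf _); exact: cvg_fst.
Qed.

(** * Graphs with at least one edge *)

Section Nonempty.
Variables (R : realType) (S : choiceType) (G : graph S) (e0 : edge G).

Local Notation N := #|edge G|.
Local Notation Y := (@othhG S G).

Let N_gt0 : (0 < N)%N.
Proof. by apply/card_gt0P; exists e0. Qed.

Lemma rot_tour0 (l : tour G) : rot_tour 0 l = l.
Proof. by apply: val_inj; rewrite /= rot0. Qed.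

Lemma rot_tour_full (l : tour G) : rot_tour N l = l.
Proof. by apply: val_inj; rewrite /= -(size_tour l) rot_size. Qed.

Lemma rot_tourD (l : tour G) m n : (m + n <= N)%N ->
  rot_tour m (rot_tour n l) = rot_tour (m + n) l.
Proof. by move=> mn; apply: val_inj; rewrite /= rotD ?size_tour. Qed.

Definition start (l : tour G) : nat := index e0 (sval l).

Lemma start_lt (l : tour G) : (start l < N)%N.
Proof. by rewrite -(size_tour l) index_mem mem_tour. Qed.

(** The position of [e0] is measured modulo N; a rotation that carries [e0] past
    the end of the listing adds N. *)
Lemma start_rot (l : tour G) c : (c <= N)%N ->
  (start (rot_tour c l) + c = start l + (if start l < c then N else 0))%N.
Proof.
move=> cN; have := uniq_tour l; have := mem_tour l e0.
have : size (take c (sval l)) = c by rewrite size_takel ?size_tour.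
have : size (drop c (sval l)) = (N - c)%N by rewrite size_drop size_tour.
rewrite /start /= -{3 4 6 7}(cat_take_drop c (sval l)) /rot.
move: (take c _) (drop c _) => A B sB sA; rewrite mem_cat cat_uniq !index_cat sA sB.
move=> eAB /and3P[_ /hasPn dis _]; case/orP: eAB => [eA|eB].
  have eB : (e0 \in B) = false by apply/negP => /dis /=; rewrite eA.
  by rewrite eA eB -[X in (_ < X)%N]sA index_mem eA addnAC subnK // addnC.
have /negbTE eA := dis _ eB; rewrite /= in eA.
by rewrite eA eB ltnNge leq_addr addn0 addnC.
Qed.

(** The rotation that begins with the reference edge [e0]: a canonical listing for
    each tour up to rotation. *)
Definition normal_tour (l : tour G) : tour G := rot_tour (start l) l.

Lemma start_normal (l : tour G) : start (normal_tour l) = 0%N.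
Proof.
have := start_rot l (ltnW (start_lt l)); rewrite ltnn addn0 => /eqP.
by rewrite -[X in _ == X]add0n eqn_add2r => /eqP.
Qed.

Lemma same_tour_rot (l : tour G) k : same_tour l (rot_tour k l).
Proof. by apply/asboolP; exists k. Qed.

(** Both listings begin with [e0], and a listing without repetition has only one
    rotation that begins with [e0]. *)
Lemma normal_tour_same (l l' : tour G) :
  same_tour l l' -> normal_tour l = normal_tour l'.
Proof.
move=> ll'; have : same_tour (normal_tour l) (normal_tour l').
  apply: same_tour_trans (same_tour_rot _ _).
  by apply: same_tour_trans ll'; rewrite same_tour_sym same_tour_rot.
move=> /asboolP[k kE].
have [Nk|kN] := leqP N k.
  by apply: val_inj; apply: etrans (esym kE); rewrite rot_oversize // size_tour.
have E : normal_tour l' = rot_tour k (normal_tour l) by exact: val_inj.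
have := start_rot (normal_tour l) (ltnW kN); rewrite -E !start_normal !add0n.
by case: ifP => [_|_] kk; rewrite E kk ?rot_tour_full ?rot_tour0.
Qed.

Definition tour_class (l : tour G) : Eul G := (\pi_(Eul G) l)%qT.

Lemma tour_class_rot k (l : tour G) : tour_class (rot_tour k l) = tour_class l.
Proof. by apply/eqmodP; rewrite /= same_tour_sym same_tour_rot. Qed.

Lemma repr_tour_class (l : tour G) :
  normal_tour (repr (tour_class l)) = normal_tour l.
Proof. by apply: normal_tour_same; have /eqmodP := reprK (tour_class l). Qed.

(** The condition for a function of a listing and of a measure on its positions to
    respect the gluing: a measure supported in [p 0, N] may as well be read on
    the listing rotated by [p 0]. *)
Definition rotation_invariant (Z : Type) (h : tour G -> @simplex R N -> Z) : Prop :=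
  forall (l : tour G) n (p q : delta_hom n N) (t : @simplex R n),
    (forall i, sval q i + sval p ord0 = sval p i)%N ->
    h (rot_tour (sval p ord0) l) (push (sval q) t) = h l (push (sval p) t).

Definition on_presimplices (Z : Type) (h : tour G -> @simplex R N -> Z)
    (a : presimplices R Y) : Z :=
  let: existT x t := a in h (tour_of (projT2 x)) (push (pos (projT2 x)) t).

Lemma on_presimplices_glued (Z : Type) (h : tour G -> @simplex R N -> Z) :
  rotation_invariant h ->
  forall m n (f : delta_hom m n) (x : Y n) (t : @simplex R m),
  on_presimplices h (presimplex (@fmor (op Delta) Sets Y n m f x) t) =
  on_presimplices h (presimplex x (push (sval f) t)).
Proof.
move=> hinv m n f x t; rewrite /on_presimplices /= push_comp.
rewrite [tour_of _](tour_of_map f x).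
exact: (hinv (tour_of x) m (mono_comp f (pos_map x)) (pos_map (restr f x)) t
  (pos_map_val f x)).
Qed.

Definition top_point (l : tour G) (w : @simplex R N) : realization R Y :=
  rclass (presimplex (full_cut e0 l : Y N) w).

Lemma top_point_continuous l : continuous (top_point l).
Proof.
move=> w; apply: continuous_comp; first exact: presimplex_continuous.
exact: rclass_continuous.
Qed.

Lemma rclass_top n (x : Y n) (t : @simplex R n) :
  rclass (presimplex x t) = top_point (tour_of x) (push (pos x) t).
Proof.
rewrite -{1}(restr_full_cut e0 x).
exact: (@rclass_glued R Y n N (pos_map x)).
Qed.

Lemma descend_top (Z : Type) (h : tour G -> @simplex R N -> Z) l w :
  rotation_invariant h -> descend (on_presimplices h) (top_point l w) = h l w.
Proof.
move=> hinv; rewrite /top_point descendE /=; last exact: on_presimplices_glued.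
rewrite tour_of_full_cut push_id_on // => i; rewrite pos_full_cut eqxx //.
Qed.

(** Both sides represent the class of one simplex [x], the pull-back of [full_cut l]
    along [p], because [x] has listing [rot (p 0) l] and positions [q]. *)
Lemma top_point_invariant : rotation_invariant top_point.
Proof.
move=> l n p q t qp; pose x := restr p (full_cut e0 l : Y N).
have tx : tour_of x = rot_tour (sval p ord0) l.
  by rewrite [LHS]tour_of_map tour_of_full_cut pos_full_cut.
have px i : pos x i = sval q i.
  apply/val_inj/eqP; rewrite -(eqn_add2r (sval p ord0)) qp.
  by have := pos_map_val p (full_cut e0 l : Y N) i; rewrite !pos_full_cut => ->.
rewrite -tx -(eq_push _ px) -rclass_top.
exact: (@rclass_glued R Y n N p (full_cut e0 l)).
Qed.

Lemma top_point_shift l (c : 'I_N.+1) (u : @simplex R N) :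
  push (cut_fun c) u = u ->
  top_point (rot_tour c l) (push (shift_fun c) u) = top_point l u.
Proof.
have cut0 : cut_fun c ord0 = c by [].
move=> cu; rewrite -{2}cu.
have := @top_point_invariant l N
  (exist (fun f => is_monotone f) _ (@cut_mono _ c) : delta_hom N N)
  (exist (fun f => is_monotone f) _ (@shift_mono _ c) : delta_hom N N) u.
by rewrite /= cut0; apply => i; exact: (shift_cut c i).
Qed.

(** The path that runs through all the vertices of the N-simplex of [l] in order,
    along its edges. *)
Definition track (l : tour G) (x : R) : realization R Y := top_point l (spread N x).

Lemma track_continuous l : continuous (track l).
Proof.
move=> x; apply: continuous_comp; first exact: spread_continuous.
exact: top_point_continuous.
Qed.

Lemma track_rot l (c : nat) x : (c <= N)%N -> c%:R <= x <= N%:R ->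
  track (rot_tour c l) (x - c%:R) = track l x.
Proof.
rewrite -ltnS => cN xc; rewrite /track -(@shift_spread R N (Ordinal cN)) //.
by apply: (@top_point_shift l (Ordinal cN)); exact: cut_spread.
Qed.

(** Rotating by N changes nothing, and translates the end of the track to its
    origin. *)
Lemma track_loop l : track l 0 = track l N%:R.
Proof. by rewrite -(@track_rot l N N%:R) ?lexx // rot_tour_full subrr. Qed.

Definition speed : R := (pi *+ 2) / N%:R.

Let N0 : N%:R != 0 :> R.
Proof. by rewrite pnatr_eq0 -lt0n. Qed.

Let speed_gt0 : 0 < speed.
Proof. by rewrite divr_gt0 ?ltr0n // mulrn_wgt0 // pi_gt0. Qed.

Let speedN : speed * N%:R = pi *+ 2.
Proof. by rewrite /speed divfK. Qed.

(** Subtracting the position of [e0] fixes the origin of the line on which all the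
    rotations of [l] are laid out: [e0] begins at 0 modulo N. *)
Definition to_circles_top (l : tour G) (w : @simplex R N) :
    coproduct (Eul G) (circle R) :=
  existT (fun=> circle R : Type) (tour_class l)
    (circle_point (speed * (mean w - (start l)%:R))).

Lemma to_circles_top_invariant : rotation_invariant to_circles_top.
Proof.
move=> l n p q t qp; rewrite /to_circles_top tour_class_rot; congr existT.
rewrite -(mean_pushD t qp); set c := sval p ord0.
have /(congr1 (fun n => n%:R : R)) := start_rot l (ltn_ord c); rewrite !natrD => E.
set m := mean _; set a := _%:R in E *.
have -> : speed * (m - a) =
   speed * (m + c%:R - (start l)%:R) -
   speed * (if (start l < c)%N then N else 0%N)%:R.
  by rewrite -mulrBr; congr (_ * _); lra.
case: ifP => _; last by rewrite mulr0 subr0.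
by rewrite speedN -circle_pointD2pi subrK.
Qed.

Lemma to_circles_top_continuous l : continuous (to_circles_top l).
Proof.
move=> w; apply: (@continuous_comp _ _ _
  (fun w => speed * (mean w - (start l)%:R))
  (fun x => existT (fun=> circle R : Type) (tour_class l) (circle_point x)
    : coproduct (Eul G) (circle R))).
  apply: (@mul_continuous R _ (cst speed) (fun w => mean w - (start l)%:R)).
    exact: cst_continuous.
  by apply: sub_continuous; [exact: mean_continuous|exact: cst_continuous].
apply: continuous_comp; first exact: circle_point_continuous.
exact: (@existT_continuous _ (fun=> circle R)).
Qed.

Definition to_circles : realization R Y -> coproduct (Eul G) (circle R) :=
  descend (on_presimplices to_circles_top).

Lemma to_circles_continuous : continuous to_circles.
Proof.
apply: descend_continuous.
  exact: on_presimplices_glued to_circles_top_invariant.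
move=> n x t; apply: (@continuous_comp _ _ _
  (push (pos x)) (to_circles_top (tour_of x))).
  exact: push_continuous.
exact: to_circles_top_continuous.
Qed.

Definition base_tour (tau : Eul G) : tour G := normal_tour (repr tau).

Definition loop (tau : Eul G) (x : R) : realization R Y :=
  track (base_tour tau) (x / speed).

Lemma loop_continuous tau : continuous (loop tau).
Proof.
move=> x; apply: (@continuous_comp R R (realization R Y)
  (fun x => x / speed) (track (base_tour tau))).
  apply: (@mul_continuous R R id (cst speed^-1)); last exact: cst_continuous.
  by move=> ?; exact: cvg_id.
exact: track_continuous.
Qed.

Lemma loop_closed tau : loop tau 0 = loop tau (pi *+ 2).
Proof.
by rewrite /loop mul0r -speedN mulrAC mulfV ?gt_eqF // mul1r track_loop.
Qed.

Definition of_circles (z : coproduct (Eul G) (circle R)) : realization R Y :=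
  let: existT tau z := z in loop tau (angle z).

Lemma of_circles_continuous : continuous of_circles.
Proof.
apply/continuousP => A oA; apply/sigT_openP => tau.
have : continuous (fun z : circle R => loop tau (angle z)).
  by apply: angle_descent; [exact: loop_continuous|exact: loop_closed].
by move/continuousP; exact.
Qed.

Lemma of_circlesK z : to_circles (of_circles z) = z.
Proof.
case: z => tau z; rewrite /of_circles /loop /track /to_circles.
rewrite descend_top; last exact: to_circles_top_invariant.
have /andP[a0 a2] := angle_itv z.
rewrite /to_circles_top mean_spread; last first.
  apply/andP; split; first by apply: divr_ge0 => //; exact: ltW.
  by rewrite ler_pdivrMr // mulrC speedN; exact: ltW.
rewrite /base_tour start_normal subr0 mulrC divfK ?gt_eqF // angleK.
by rewrite tour_class_rot [tour_class _]reprK.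
Qed.

(** The angle of the class of [w] gives its mean back up to a translation by N,
    according to the side of [e0] on which the mean lies; in both cases rotating the
    normal listing back to [l] undoes the translation. *)
Lemma to_circles_topK l w : of_circles (to_circles_top l w) = track l (mean w).
Proof.
rewrite /to_circles_top /of_circles.
have /andP[m0 mN] := mean_itv w; have sN := start_lt l.
have s0 : 0 <= (start l)%:R :> R by [].
have sN' : (start l)%:R < N%:R :> R by rewrite ltr_nat.
have loopE x : 0 <= x <= N%:R ->
    loop (tour_class l) (angle (circle_point (speed * x))) = track (normal_tour l) x.
  move=> /andP[x0 xN]; rewrite (angle_comp (loop_closed _)); last first.
    apply/andP; split; first by apply: mulr_ge0 => //; exact: ltW.
    by rewrite -speedN ler_pM2l.
  by rewrite /loop /base_tour repr_tour_class mulrC mulKf ?gt_eqF.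
have [sm|ms] := leP (start l)%:R (mean w).
  rewrite loopE; last by apply/andP; split; lra.
  by rewrite /normal_tour track_rot ?sm // ltnW.
have -> : circle_point (speed * (mean w - (start l)%:R)) =
    circle_point (speed * (mean w + (N - start l)%:R)).
  rewrite -circle_pointD2pi -speedN -mulrDr natrB ?(ltnW sN) //.
  by congr (circle_point (_ * _)); ring.
have Nm : (N - start l)%:R = N%:R - (start l)%:R :> R by rewrite natrB // ltnW.
rewrite loopE; last by rewrite Nm; apply/andP; split; lra.
rewrite -(@track_rot _ (N - start l)) ?leq_subr //; last first.
  by rewrite Nm; apply/andP; split; lra.
by rewrite addrK /normal_tour rot_tourD subnK ?(ltnW sN) // rot_tour_full.
Qed.

Definition contraction_top (l : tour G) (w : @simplex R N) (s : R) :
    realization R Y :=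
  top_point l (blend s (spread N (mean w)) w).

(** Translating the measure translates its mean, hence the two-point measure of
    that mean, and the latter is supported in [c, N] when the measure is. *)
Lemma contraction_top_invariant : rotation_invariant contraction_top.
Proof.
move=> l n p q t qp; apply/funext => s; rewrite /contraction_top.
set c := sval p ord0.
have cp i : (c <= sval p i)%N by exact: (svalP p).
have pE : push (sval p) t = push (cut_fun c) (push (sval p) t).
  rewrite push_comp; apply: eq_push => i; rewrite /= /cut_fun.
  by case: leqP => // pc; apply/val_inj/eqP; rewrite eqn_leq pc cp.
have qE : push (sval q) t = push (shift_fun c) (push (sval p) t).
  by rewrite push_comp; apply: eq_push => i; apply/val_inj; rewrite /= -qp addnK.
have mE := mean_pushD t qp.
have mp : c%:R <= mean (push (sval p) t) <= N%:R.
  have /andP[_ ->] := mean_itv (push (sval p) t).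
  by rewrite -mE lerDr; case/andP: (mean_itv (push (sval q) t)) => ->.
have -> : mean (push (sval q) t) = mean (push (sval p) t) - c%:R.
  by rewrite -mE addrK.
rewrite qE -shift_spread // -push_blend top_point_shift //.
by rewrite push_blend -pE cut_spread.
Qed.

Definition contraction (p : realization R Y * R) : realization R Y :=
  descend (on_presimplices contraction_top) p.1 p.2.

Lemma contraction_continuous : continuous contraction.
Proof.
apply: descend_homotopy_continuous.
  exact: on_presimplices_glued contraction_top_invariant.
move=> n x; have cf : continuous (fun p : @simplex R n * R => push (pos x) p.1).
  by move=> p; apply: continuous_comp; [exact: cvg_fst|exact: push_continuous].
have cs : continuous (fun p : @simplex R n * R =>
    spread N (mean (push (pos x) p.1))).
  move=> p; apply: (@continuous_comp _ _ _
    (fun p : @simplex R n * R => push (pos x) p.1) (fun w => spread N (mean w))).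
    exact: cf.
  by apply: continuous_comp; [exact: mean_continuous|exact: spread_continuous].
have cb := @blend_continuous R N _ snd _ _ (fun p => @cvg_snd _ _ _ _ _) cs cf.
move=> p; apply: (@continuous_comp _ _ _
  (fun p : @simplex R n * R =>
    blend p.2 (spread N (mean (push (pos x) p.1))) (push (pos x) p.1))
  (top_point (tour_of x))).
  exact: cb.
exact: top_point_continuous.
Qed.

Lemma nonempty_equivalence :
  homotopy_equivalent R (realization R Y) (coproduct (Eul G) (circle R)).
Proof.
exists to_circles, of_circles; split.
- exact: to_circles_continuous.
- exact: of_circles_continuous.
- exists contraction; split.
  + by apply: continuous_subspaceT; exact: contraction_continuous.
  + move=> y; have [n [x [t ->]]] := rclass_surj y; rewrite rclass_top.
    rewrite /contraction /= (descend_top _ _ contraction_top_invariant).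
    rewrite /contraction_top blend0 /to_circles.
    by rewrite (descend_top _ _ to_circles_top_invariant) to_circles_topK.
  + move=> y; have [n [x [t ->]]] := rclass_surj y; rewrite rclass_top.
    rewrite /contraction /= (descend_top _ _ contraction_top_invariant).
    by rewrite /contraction_top blend1.
- apply: eq_homotopic => [z|z]; last exact: of_circlesK.
  apply: continuous_comp; first exact: of_circles_continuous.
  exact: to_circles_continuous.
Qed.

End Nonempty.

(** * Graphs without edges *)

Section Empty.
Variables (R : realType) (S : choiceType) (G : graph S).
Hypothesis G0 : #|edge G| = 0%N.

Local Notation Y := (@othhG S G).

Let no_edge (e : edge G) : False.
Proof. by have := card0_eq G0 e. Qed.

Lemma label_const n (x : Y n) i : projT1 x i = projT1 x ord0.
Proof.
have := stretch_walk x ord0 i; rewrite iter_ordS0.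
by case: (stretch x ord0 i) => [/eqP ->|e] //; case: (no_edge e).
Qed.

Section Point.
Variable s : S.

Lemma point_subproofE (i : 'I_1) (e : edge G) : (e \in [::]) = (ord0 == i).
Proof. by case: (no_edge e). Qed.

Lemma point_walk (i : 'I_1) : @walk S G s [::] s.
Proof. exact: eqxx. Qed.

Definition point : Y 0%N :=
  existT _ (fun=> s) (@Bypass S G (cycle_graph (fun _ : 'I_1 => s)) (fun=> ord0)
    (fun=> [::]) (fun=> isT) point_subproofE point_walk).

End Point.

Definition collapse n : delta_hom n 0 :=
  exist (fun f => is_monotone f) (fun=> ord0) (fun _ _ _ => leqnn 0).

(** Every simplex is degenerate on a vertex. *)
Lemma restr_point n (x : Y n) : restr (collapse n) (point (projT1 x ord0)) = x.
Proof.
have : projT1 x = projT1 (restr (collapse n) (point (projT1 x ord0))).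
  by apply/funext => i; rewrite label_const.
move: (restr _ _) => y; case: x y => [X x] [X' y] /= XX'.
case: _ / XX' y => y; congr existT; apply: bypass_ext => i.
by case: (bp_fib x i) => [|e]; [case: (bp_fib y i) => [|e] //|]; case: (no_edge e).
Qed.

Lemma simplex0_eq (t u : @simplex R 0) : t = u.
Proof.
apply: simplex_ext => i; rewrite (ord1 i).
by have := weight_sum t; have := weight_sum u; rewrite !big_ord1 => -> ->.
Qed.

Definition label_of (a : presimplices R Y) : discrete_topology S :=
  projT1 (projT2 (projT1 a)) ord0.

Lemma label_of_glued m n (f : delta_hom m n) (x : Y n) (t : @simplex R m) :
  label_of (presimplex (@fmor (op Delta) Sets Y n m f x) t) =
  label_of (presimplex x (push (sval f) t)).
Proof. exact: (label_const x (sval f ord0)). Qed.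

Definition of_label (s : discrete_topology S) : realization R Y :=
  rclass (presimplex (point s) (spread 0 (0 : R))).

Lemma empty_equivalence :
  homotopy_equivalent R (realization R Y) (discrete_topology S).
Proof.
have cl : continuous (descend label_of).
  apply: descend_continuous; first exact: label_of_glued.
  move=> n x.
  exact: (@cst_continuous (@simplex R n) (discrete_topology S) (projT1 x ord0)).
have co : continuous of_label.
  by apply/continuousP => A _; exact: discrete_open.
exists (descend label_of), of_label; split => //; apply: eq_homotopic.
- by move=> y; apply: continuous_comp; [exact: cl|exact: co].
- move=> y; have [n [x [t ->]]] := rclass_surj y.
  rewrite /= descendE; last exact: label_of_glued.
  rewrite /of_label -{2}(restr_point x) /label_of /=.
  rewrite [RHS](@rclass_glued R Y n 0 (collapse n)).
  apply: (congr1 (fun u => rclass (presimplex (point (projT1 x ord0)) u))).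
  exact: simplex0_eq.
- by move=> y; apply: continuous_comp; [exact: co|exact: cl].
- by move=> s; rewrite /= /of_label descendE //; exact: label_of_glued.
Qed.

End Empty.

Theorem corollary8p3 (R : realType) (S : choiceType) (G : graph S) :
  ((0 < #|edge G|)%N ->
     homotopy_equivalent R (Othh R G) (coproduct (Eul G) (circle R))) /\
  (#|edge G| = 0%N ->
     homotopy_equivalent R (Othh R G) (discrete_topology S)).
Proof.
split=> [/card_gt0P[e0 _]|G0]; first exact: nonempty_equivalence e0.
exact: empty_equivalence.
Qed.
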